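(* Let $\lambda>0$ be a constant and let $(p_n)$ be a sequence in $[0,1]$ with $$p_n = 1-\frac{1}{\sqrt 3}\,\lambda^{1/(2n)}\bigl(1+o(1/n)\bigr)\qquad (n\to\infty).$$ Then, as $n\to\infty$, the probability that ${}^3Q^n_{p_n}$ has no isolated vertex tends to $e^{-\lambda}$, and the probability that ${}^3Q^n_{p_n}$ is connected tends to $e^{-\lambda}$.
   Context: For a positive integer $n$, the 3-cube ${}^3Q^n$ is the simple graph with vertex set $\{0,1,\dots,3^n-1\}$ in which two vertices are adjacent if and only if their ternary (base 3, $n$-digit) representations differ in exactly one digit; equivalently, it is the Cartesian product of $n$ copies of the complete graph $K_3$. It is $2n$-regular. For $p\in[0,1]$, the random subgraph ${}^3Q^n_{p}$ contains all vertices of ${}^3Q^n$ and each edge of ${}^3Q^n$ independently with probability $p$. A vertex is isolated if it has no incident edge in the random subgraph. The notation $o(1/n)$ denotes a quantity $\varepsilon_n$ with $n\varepsilon_n\to 0$. *)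

(* Defs.v *)
From HB Require Import structures.
From mathcomp Require Import all_boot all_order all_algebra.
From mathcomp Require Import reals.
Set Implicit Arguments.
Unset Strict Implicit.
Unset Printing Implicit Defensive.
Import Order.TTheory GRing.Theory Num.Theory.

Local Open Scope ring_scope.

Section Graph.
Variable V : finType.

(* An edge is the two-element set of its ends; [adj] is meant to be symmetric
   and irreflexive. *)
Definition edges (adj : rel V) : {set {set V}} :=
  [set e : {set V} | [exists x, exists y, adj x y && (e == [set x; y])]].

(* A spanning subgraph is identified with its set [F] of edges. *)
Definition isolated (F : {set {set V}}) (v : V) : bool :=
  [forall e in F, v \notin e].

Definition no_isolated (F : {set {set V}}) : bool :=
  [forall v, ~~ isolated F v].

(* True on the empty graph, which does not arise for [V] = 'I_(3 ^ n). *)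
Definition connected_graph (F : {set {set V}}) : bool :=
  [forall x, forall y, connect [rel u v | [set u; v] \in F] x y].

(* The probability that the random subgraph, in which every edge is kept
   independently with probability [p], has the property [P]: the mass of an
   edge set is the product over all edges of [p] (kept) or [1 - p] (deleted). *)
Definition random_subgraph_prob (R : realType) (adj : rel V) (p : R)
    (P : pred {set {set V}}) : R :=
  \sum_(F in powerset (edges adj) | P F)
    \prod_(e in edges adj) (if e \in F then p else 1 - p).

End Graph.

Definition digit3 (x i : nat) : nat := ((x %/ 3 ^ i) %% 3)%N.

Definition cube3_adj (n : nat) : rel 'I_(3 ^ n) :=
  fun x y => #|[set i : 'I_n | digit3 x i != digit3 y i]| == 1%N.

Lemma cube3_adj_sym (n : nat) : symmetric (@cube3_adj n).
Proof.
move=> x y; rewrite /cube3_adj; congr (_ == _); apply: eq_card => i.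
by rewrite !inE eq_sym.
Qed.

Lemma cube3_adj_irr (n : nat) : irreflexive (@cube3_adj n).
Proof.
move=> x; rewrite /cube3_adj (_ : [set i | _] = set0) ?cards0 //.
by apply/setP => i; rewrite !inE eqxx.
Qed.

Lemma random_subgraph_probT (V : finType) (R : realType) (adj : rel V) (p : R) :
  random_subgraph_prob adj p xpredT = 1.
Proof.
rewrite /random_subgraph_prob.
under eq_bigl do rewrite andbT.
set E := edges adj.
pose F (e : {set V}) := if e \in E then p else 0.
pose G (e : {set V}) := if e \in E then 1 - p else 1.
transitivity (\prod_e (F e + G e)); last first.
  rewrite big1 // => e _; rewrite /F /G; case: (e \in E); last by rewrite add0r.
  by rewrite addrC subrK.
rewrite bigA_distr [RHS](bigID (fun A => A \in powerset E)) /=.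
rewrite [X in _ = _ + X]big1 ?addr0.
  apply: eq_bigr => A; rewrite powersetE => /subsetP sAE.
  rewrite [LHS]big_mkcond /=; apply: eq_bigr => e _; rewrite /F /G.
  case: (boolP (e \in A)) => [/sAE -> //|_].
  by case: (e \in E).
move=> A; rewrite powersetE => /subsetPn [e eA eE].
by rewrite (bigD1 e) //= eA /F (negbTE eE) mul0r.
Qed.

(* Main.v *)
Require Import Defs.
From HB Require Import structures.
From mathcomp Require Import all_boot all_order all_algebra.
From mathcomp Require Import reals zify ring lra.
Set Implicit Arguments.
Unset Strict Implicit.
Unset Printing Implicit Defensive.
Import Order.TTheory GRing.Theory Num.Theory.
Local Open Scope ring_scope.

(** Write [q = 1 - p] and [N = 3 ^ n]; the hypothesis on [p] says that
    [N * q ^ (2 n)], the mean number of isolated vertices, tends to [lambda].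

    A [k]-set of vertices touches [2 n k] edges when it is independent and at
    least [k (2 n - k)] edges otherwise, and the dependent [k]-sets are a
    fraction [O(n / N)] of all. Hence the [k]-th binomial moment of the number
    of isolated vertices tends to [lambda ^ k / k!], and the Bonferroni
    inequalities squeeze the probability of having none to [exp (- lambda)].

    A disconnected graph without isolated vertices either has a component of
    size between 2 and [K], or has two adjacent vertices in distinct components,
    each with more than [K] vertices, for a constant [K]. The first case has
    probability at most [poly(n) * N * q ^ (4 n) = poly(n) / N]. In the second
    case both components contain a [(K+1)]-set, [S] and [T], inside a common
    subcube of bounded dimension. For each of about [n / 2] directions [i], look
    for an open edge in direction [i] leaving [S], one leaving [T], and a second
    direction [j], among the remaining [n / 2], such that the translate of the
    subcube along [i] and [j] is completely open and completely joined to the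
    translate along [i]. This joins [S] to [T]; it fails with probability about
    [2 q ^ (K+1)], independently for distinct [i], so for [K] large all the
    directions fail with probability at most [27 ^ - n] up to a constant factor,
    which beats the [poly(n) * N] choices of [S] and [T]. *)

(** * Events on independent edges *)

Section ProductMeasure.
Variables (R : realType) (T : finType) (E : {set T}) (p : R).
Hypothesis p01 : 0 <= p <= 1.

(** Elements outside [E] are closed with probability one. The weight is thus a product over the
    whole type, to which distributivity applies directly, and it vanishes on sets that are not
    contained in [E]. *)
Definition coin (e : T) (b : bool) : R :=
  if e \in E then (if b then p else 1 - p) else (~~ b)%:R.

Definition weight (F : {set T}) : R := \prod_e coin e (e \in F).

Definition prob (A : pred {set T}) : R := \sum_(F | A F) weight F.

(** Measurability with respect to the edges of [X]; independence is expressed below by disjoint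
    supports. *)
Definition supported (A : pred {set T}) (X : {set T}) : Prop :=
  forall F G : {set T}, F :&: X = G :&: X -> A F = A G.

Lemma sum_prod_set (h : T -> bool -> R) :
  \sum_(F : {set T}) \prod_e h e (e \in F) = \prod_e (h e true + h e false).
Proof.
rewrite bigA_distr; apply: eq_bigr => F _; apply: eq_bigr => e _.
by case: (e \in F).
Qed.

Lemma coinD e : coin e true + coin e false = 1.
Proof. by rewrite /coin; case: (e \in E); rewrite ?add0r // addrC subrK. Qed.

Lemma coin_ge0 e b : 0 <= coin e b.
Proof.
case/andP: p01 => p0 p1; rewrite /coin.
by case: (e \in E); case: b; rewrite ?subr_ge0 ?ler0n.
Qed.

Lemma weight_ge0 F : 0 <= weight F.
Proof. by apply: prodr_ge0 => e _; apply: coin_ge0. Qed.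

Lemma probT : prob xpredT = 1.
Proof. by rewrite /prob sum_prod_set big1 // => e _; apply: coinD. Qed.

Lemma prob_ge0 A : 0 <= prob A.
Proof. by apply: sumr_ge0 => F _; apply: weight_ge0. Qed.

(** Restricting the implication to sets of nonzero weight makes [F \subset E] available in later
    comparisons, through [weight_subset]. *)
Lemma le_prob (A B : pred {set T}) : (forall F, weight F != 0 -> A F -> B F) -> prob A <= prob B.
Proof.
move=> AB; rewrite /prob [leLHS]big_mkcond [leRHS]big_mkcond /=.
apply: ler_sum => F _; have [w0|w0] := eqVneq (weight F) 0.
  by rewrite w0 !if_same.
case: ifP => [/(AB F w0) -> //|_]; case: ifP => // _; exact: weight_ge0.
Qed.

Lemma weight_subset F : weight F != 0 -> F \subset E.
Proof.
apply: contraR => /subsetPn [e eF eE]; rewrite /weight (bigD1 e) //=.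
by rewrite /coin (negPf eE) eF mul0r.
Qed.

Lemma prob_indicator A : prob A = \sum_F weight F * (A F)%:R.
Proof.
rewrite /prob big_mkcond; apply: eq_bigr => F _.
by case: (A F); rewrite ?mulr1 ?mulr0.
Qed.

Lemma prob_predC A : prob (predC A) = 1 - prob A.
Proof.
rewrite -probT /prob [X in _ = X - _](bigID A) /= [X in _ = X - _]addrC.
by rewrite addrK.
Qed.

Lemma prob_predU A B : prob (predU A B) <= prob A + prob B.
Proof.
rewrite !prob_indicator -big_split; apply: ler_sum => F _ /=.
rewrite -mulrDr ler_wpM2l ?weight_ge0 // -natrD ler_nat.
by case: (A F); case: (B F).
Qed.

Lemma prob_exists (I : finType) (C : pred I) (A : I -> pred {set T}) :
  prob [pred F | [exists (i | C i), A i F]] <= \sum_(i | C i) prob (A i).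
Proof.
under [leRHS]eq_bigr => i _ do rewrite prob_indicator.
rewrite prob_indicator exchange_big /=; apply: ler_sum => F _.
rewrite -mulr_sumr ler_wpM2l ?weight_ge0 //.
case: existsP => [[i /andP[Ci Ai]]|_]; last by apply: sumr_ge0 => i _; rewrite ler0n.
rewrite (bigD1 i) //= Ai lerDl; apply: sumr_ge0 => j _; exact: ler0n.
Qed.

Lemma prob_all_closed (X : {set T}) : X \subset E ->
  prob [pred F : {set T} | [disjoint X & F]] = (1 - p) ^+ #|X|.
Proof.
move=> sXE; rewrite prob_indicator.
(* The indicator of the event is itself a product over edges; absorbed into the coins, it lets
   [sum_prod_set] factor the whole sum. *)
pose h e b := coin e b * (~~ (b && (e \in X)))%:R.
transitivity (\sum_(F : {set T}) \prod_e h e (e \in F)).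
  apply: eq_bigr => F _; rewrite big_split /=; congr (_ * _).
  case: (boolP [disjoint X & F]) => [dXF|].
    rewrite big1 // => e _; case: (boolP (e \in F)) => //= eF.
    by rewrite (disjointFl dXF eF).
  rewrite -setI_eq0 => /set0Pn [e /setIP[eX eF]].
  by rewrite (bigD1 e) //= eX eF mul0r.
rewrite sum_prod_set (bigID (mem X)) /= [X in _ * X]big1 => [|e eX].
  rewrite mulr1 -prodr_const; apply: eq_bigr => e eX.
  by rewrite /h /coin eX (subsetP sXE _ eX) mulr0 add0r mulr1.
by rewrite /h (negPf eX) /= !mulr1 coinD.
Qed.

Lemma prob_all_open (X : {set T}) : X \subset E ->
  prob [pred F : {set T} | X \subset F] = p ^+ #|X|.
Proof.
move=> sXE; rewrite prob_indicator.
pose h e b := coin e b * (~~ (~~ b && (e \in X)))%:R.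
transitivity (\sum_(F : {set T}) \prod_e h e (e \in F)).
  apply: eq_bigr => F _; rewrite big_split /=; congr (_ * _).
  case: (boolP (X \subset F)) => [/subsetP dXF|].
    rewrite big1 // => e _; case: (boolP (e \in X)) => [/dXF -> //|].
    by rewrite andbF.
  by move=> /subsetPn [e eX eF]; rewrite (bigD1 e) //= eX eF mul0r.
rewrite sum_prod_set (bigID (mem X)) /= [X in _ * X]big1 => [|e eX].
  rewrite mulr1 -prodr_const; apply: eq_bigr => e eX.
  by rewrite /h /coin eX (subsetP sXE _ eX) mulr0 addr0 mulr1.
by rewrite /h (negPf eX) /= !mulr1 coinD.
Qed.

Lemma supportedS A (X Y : {set T}) : X \subset Y -> supported A X -> supported A Y.
Proof.
move=> sXY sA F G FG; apply: sA.
by rewrite -(setIidPr sXY) !setIA FG.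
Qed.

(* Exchanging the [X]-parts of two independent samples preserves the product
   weight; it turns a pair of events on separate samples into a single one. *)
Lemma prob_predI A B (X : {set T}) : supported A X -> supported B (~: X) ->
  prob (predI A B) = prob A * prob B.
Proof.
move=> sA sB.
pose mix (F G : {set T}) := (F :&: X) :|: (G :\: X).
have mixE F G e : (e \in mix F G) = if e \in X then e \in F else e \in G.
  by rewrite !inE; case: (e \in X); rewrite ?andbT ?andbF ?orbF.
pose sw (FG : {set T} * {set T}) := (mix FG.1 FG.2, mix FG.2 FG.1).
have swK : involutive sw.
  case=> F G; rewrite /sw /=; congr (_, _); apply/setP => e;
  by rewrite !mixE; case: (e \in X).
have wsw F G : weight (mix F G) * weight (mix G F) = weight F * weight G.
  rewrite /weight -!big_split; apply: eq_bigr => e _ /=.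
  by rewrite !mixE; case: (e \in X) => //; rewrite mulrC.
have mA F G : A (mix F G) = A F.
  apply: sA; apply/setP => e; rewrite in_setI mixE in_setI.
  by case: (e \in X); rewrite ?andbF.
have mB F G : B (mix F G) = B G.
  apply: sB; apply/setP => e; rewrite in_setI mixE !inE.
  by case: (e \in X); rewrite ?andbF.
rewrite -[LHS]mulr1 -[X in _ * X]probT !prob_indicator !big_distrlr /=.
rewrite !pair_bigA /= (reindex_inj (inv_inj swK)) /=.
apply: eq_bigr => -[F G] _ /=; rewrite mA mB mulr1 mulrACA -natrM mulnb.
by rewrite -wsw mulrAC.
Qed.

(** Induction on [r]: by disjointness the events of the tail are all supported on the complement of
    the first support. *)
Lemma prob_all (I : eqType) (r : seq I) (A : I -> pred {set T}) (X : I -> {set T}) :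
  uniq r -> (forall i, i \in r -> supported (A i) (X i)) ->
  (forall i j, i \in r -> j \in r -> i != j -> [disjoint X i & X j]) ->
  prob [pred F | all (fun i => A i F) r] = \prod_(i <- r) prob (A i).
Proof.
elim: r => [_ _ _|i r IH /= /andP[ir ur] sA dX]; first by rewrite big_nil -probT.
rewrite big_cons -IH //; last 2 first.
- by move=> j jr; apply: sA; rewrite inE jr orbT.
- by move=> j k jr kr; apply: dX; rewrite inE ?jr ?kr orbT.
apply: (@prob_predI (A i) _ (X i)); first by apply: sA; rewrite inE eqxx.
move=> F G FG /=; apply: eq_in_all => j jr.
apply: (supportedS _ (sA j _) FG); last by rewrite inE jr orbT.
rewrite -disjoints_subset; apply: dX; rewrite ?inE ?jr ?eqxx ?orbT //.
by apply: contraNneq ir => <-.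
Qed.

Lemma supported_predC A X : supported A X -> supported (predC A) X.
Proof. by move=> sA F G /sA /= ->. Qed.

Lemma supported_open (X : {set T}) : supported [pred F : {set T} | X \subset F] X.
Proof.
move=> F G FG /=.
by apply/setIidPl/setIidPl; rewrite ![X :&: _]setIC FG.
Qed.

Lemma supported_closed (X : {set T}) : supported [pred F : {set T} | [disjoint X & F]] X.
Proof. by move=> F G FG /=; rewrite -!setI_eq0 ![X :&: _]setIC FG. Qed.

End ProductMeasure.

Lemma random_subgraph_probE (V : finType) (R : realType) (adj : rel V) (p : R) P :
  random_subgraph_prob adj p P = prob (edges adj) p P.
Proof.
rewrite /random_subgraph_prob /prob [RHS](bigID (fun A => A \in powerset (edges adj))) /=.
rewrite [X in _ = _ + X]big1 ?addr0 => [|F /andP[_]].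
  rewrite big_andbC; apply: eq_bigr => F /andP[_]; rewrite powersetE => /subsetP sFE.
  rewrite [LHS]big_mkcond /=; apply: eq_bigr => e _; rewrite /coin.
  by case: (boolP (e \in edges adj)) => // /(contra (sFE e)) ->.
by rewrite powersetE => /negP sFE; apply/eqP/negPn/negP => /weight_subset.
Qed.

(** * Graphs and subcubes *)

Section Graphs.
Variables (V : finType) (adj : rel V).
Hypotheses (adj_sym : symmetric adj) (adj_irr : irreflexive adj).

Definition boundary (S : {set V}) : {set {set V}} :=
  [set e | [exists x in S, exists y in ~: S, adj x y && (e == [set x; y])]].

Definition touching (S : {set V}) : {set {set V}} :=
  [set e in edges adj | ~~ [disjoint S & e]].

Definition component (F : {set {set V}}) (x : V) : {set V} :=
  [set y | connect [rel u v | [set u; v] \in F] x y].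

Lemma in_edges x y : ([set x; y] \in edges adj) = adj x y.
Proof.
rewrite inE; apply/existsP/idP => [[a /existsP[b /andP[ab /eqP E]]]|xy]; last first.
  by exists x; apply/existsP; exists y; rewrite xy eqxx.
have anb : a != b by apply: contraTneq ab => ->; rewrite adj_irr.
have : x \in [set a; b] by rewrite -E set21.
have : y \in [set a; b] by rewrite -E set22.
have : a \in [set x; y] by rewrite E set21.
have : b \in [set x; y] by rewrite E set22.
rewrite !inE => /orP[]/eqP h1 /orP[]/eqP h2; subst; rewrite ?eqxx in anb => //.
  by rewrite adj_sym.
Qed.

Lemma boundary_edges (S : {set V}) : boundary S \subset edges adj.
Proof.
apply/subsetP => e; rewrite inE => /existsP[x /andP[_ /existsP[y /andP[_]]]].
by move=> /andP[xy /eqP ->]; rewrite in_edges.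
Qed.

Lemma boundary_touching (S : {set V}) : boundary S \subset touching S.
Proof.
apply/subsetP => e eS; rewrite inE (subsetP (boundary_edges S)) //=.
move: eS; rewrite inE => /existsP[x /andP[xS /existsP[y /andP[_ /andP[_ /eqP ->]]]]].
by rewrite -setI_eq0; apply/set0Pn; exists x; rewrite !inE xS eqxx.
Qed.

(** Pairs with first entry in [S] and second entry outside map injectively to edges, since [S] tells
    the two ends apart. *)
Lemma card_boundary_sum (S : {set V}) :
  (\sum_(x in S) #|[set y | adj x y] :\: S| <= #|boundary S|)%N.
Proof.
pose P := [set xy : V * V | [&& xy.1 \in S, xy.2 \notin S & adj xy.1 xy.2]].
have -> : (\sum_(x in S) #|[set y | adj x y] :\: S| = #|P|)%N.
  transitivity (\sum_(x in S) \sum_(y | (y \notin S) && adj x y) 1)%N.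
    apply: eq_bigr => x _; rewrite -sum1_card; apply: eq_bigl => y.
    by rewrite !inE.
  rewrite pair_big_dep /= sum1_card; apply: eq_card => -[x y].
  by rewrite !inE.
rewrite -(card_in_imset (f := fun xy : V * V => [set xy.1; xy.2])) => [|[x y] [a b]].
  apply/subset_leq_card/subsetP => e /imsetP[[x y]]; rewrite inE /= => /and3P[xS yS xy] ->.
  rewrite inE; apply/existsP; exists x; rewrite xS; apply/existsP; exists y.
  by rewrite inE yS xy eqxx.
rewrite !inE /= => /and3P[xS yS xy] /and3P[aS bS ab] E.
have : x \in [set a; b] by rewrite -E set21.
have : y \in [set a; b] by rewrite -E set22.
rewrite !inE => /orP[]/eqP h1 /orP[]/eqP h2; subst => //; by rewrite ?xS ?aS in yS bS.
Qed.

Lemma closed_component (F : {set {set V}}) x : F \subset edges adj -> [disjoint boundary (component F x) & F].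
Proof.
move=> sF; rewrite -setI_eq0 -subset0; apply/subsetP => e /setIP[+ eF].
rewrite !inE => /existsP[a /andP[+ /existsP[b /andP[+ /andP[_ /eqP E]]]]].
rewrite !inE => xa /negP[]; apply: (connect_trans xa); apply: connect1.
by rewrite /= -E.
Qed.

Lemma connect_sym_subgraph (F : {set {set V}}) :
  connect_sym [rel u v | [set u; v] \in F].
Proof. by apply: sym_connect_sym => x y /=; rewrite setUC. Qed.

Lemma connect_crossing (e : rel V) (S : {set V}) x y :
  connect e x y -> x \in S -> y \notin S -> exists a b, [/\ a \in S, b \notin S & e a b].
Proof.
case/connectP => s; elim: s x => [x _ -> -> //|z s IH x /= /andP[xz zs] yE xS yS].
have [zS|zS] := boolP (z \in S); first exact: IH zs yE zS yS.
by exists x, z.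
Qed.

(** This turns simultaneous isolation of [S] into an event of the form handled by
    [prob_all_closed]. *)
Lemma isolated_subsetE (F : {set {set V}}) (S : {set V}) : F \subset edges adj ->
  (S \subset [set v | isolated F v]) = [disjoint touching S & F].
Proof.
move=> sF; apply/subsetP/idP => [h|h x xS].
  rewrite -setI_eq0 -subset0; apply/subsetP => e /setIP[]; rewrite inE => /andP[_].
  rewrite -setI_eq0 => /set0Pn[x /setIP[/h + xe]] eF; rewrite inE.
  by move=> /forallP/(_ e); rewrite eF xe.
rewrite inE; apply/forallP => e; apply/implyP => eF; apply/negP => xe.
have : e \in touching S :&: F.
  rewrite in_setI eF andbT in_set (subsetP sF) //= -setI_eq0; apply/set0Pn; exists x.
  by rewrite inE xS.
by rewrite -setI_eq0 in h; rewrite (eqP h) inE.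
Qed.

Variable r : nat.
Hypothesis regular : forall x, #|[set y | adj x y]| = r.

(** A vertex has at most [#|S|] of its [r] neighbours inside [S]. *)
Lemma card_boundary (S : {set V}) : (#|S| * (r - #|S|) <= #|boundary S|)%N.
Proof.
apply: leq_trans (card_boundary_sum S); rewrite -sum_nat_const leq_sum // => x _.
by rewrite cardsD regular leq_sub2l // subset_leq_card // subsetIr.
Qed.

Lemma card_boundary_indep (S : {set V}) : (forall x y, x \in S -> y \in S -> ~~ adj x y) ->
  (#|S| * r <= #|boundary S|)%N.
Proof.
move=> indS; apply: leq_trans (card_boundary_sum S); rewrite -sum_nat_const.
apply: leq_sum => x xS; rewrite -(regular x); apply/subset_leq_card/subsetP => y.
by rewrite !inE => xy; rewrite xy andbT; apply: contraL xy; apply: indS.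
Qed.

Lemma card_touching (S : {set V}) : (#|touching S| <= #|S| * r)%N.
Proof.
have sub : touching S \subset
    \bigcup_(x in S) [set [set x; y] | y in [set y | adj x y]].
  apply/subsetP => e; rewrite !inE => /andP[/existsP[a /existsP[b /andP[ab /eqP ->]]]].
  rewrite -setI_eq0 => /set0Pn[x /setIP[xS]]; rewrite !inE => /orP[]/eqP xE; subst x.
    by apply/bigcupP; exists a => //; apply/imsetP; exists b; rewrite ?inE.
  apply/bigcupP; exists b => //; apply/imsetP; exists a; first by rewrite inE adj_sym.
  by rewrite setUC.
apply: leq_trans (subset_leq_card sub) _.
rewrite -sum_nat_const.
apply: (big_ind2 (fun (A : {set {set V}}) k => #|A| <= k)%N).
- by rewrite cards0.
- by move=> A a B b hA hB; rewrite (leq_trans (leq_card_setU A B)) // leq_add.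
- by move=> x _; rewrite (leq_trans (leq_imset_card _ _)) ?regular.
Qed.

End Graphs.

(** * The graph of ternary words at Hamming distance one, through a coordinate bijection *)

Section Cube.
Variables (n : nat) (V : finType).
Variables (dg : V -> {ffun 'I_n -> 'I_3}) (ug : {ffun 'I_n -> 'I_3} -> V).
Hypotheses (dgK : cancel dg ug) (ugK : cancel ug dg).
Variable adj : rel V.
Hypothesis adjE : forall x y, adj x y = (#|[set i | dg x i != dg y i]| == 1%N).

Definition upd (x : V) (i : 'I_n) (a : 'I_3) : V :=
  ug [ffun k => if k == i then a else dg x k].

Definition subcube (u : V) (t : seq 'I_n) : {set V} :=
  [set x | [forall i, (i \in t) || (dg x i == dg u i)]].

Lemma dg_upd x i a k : dg (upd x i a) k = if k == i then a else dg x k.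
Proof. by rewrite ugK ffunE. Qed.

Lemma dg_ext x y : (forall k, dg x k = dg y k) -> x = y.
Proof. by move=> E; apply: (can_inj dgK); apply/ffunP. Qed.

Lemma cube_sym : symmetric adj.
Proof.
by move=> x y; rewrite !adjE; congr (_ == _); apply: eq_card => i; rewrite !inE eq_sym.
Qed.

Lemma cube_irr : irreflexive adj.
Proof.
move=> x; rewrite adjE (_ : [set i | _] = set0) ?cards0 //.
by apply/setP => i; rewrite !inE eqxx.
Qed.

Lemma adj_upd x i a : a != dg x i -> adj x (upd x i a).
Proof.
move=> ax; rewrite adjE (_ : [set k | _] = [set i]) ?cards1 //.
apply/setP => k; rewrite !inE dg_upd; case: (eqVneq k i) => [->|_].
  by rewrite eq_sym.
by rewrite eqxx.
Qed.

Lemma adjP x y : adj x y -> exists2 i, dg y i != dg x i & y = upd x i (dg y i).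
Proof.
rewrite adjE => /cards1P[i E]; exists i.
  by move/setP: E => /(_ i); rewrite !inE eqxx eq_sym.
apply: dg_ext => k; rewrite dg_upd; case: eqVneq => [->//|ki].
by move/setP: E => /(_ k); rewrite !inE (negPf ki) => /negbFE/eqP.
Qed.

Lemma card_nbr x : #|[set y | adj x y]| = (2 * n)%N.
Proof.
(* Neighbours are indexed by a direction and a sign: in ['I_3], read as the integers mod 3, the two
   digits other than d are d + 1 and d - 1. *)
pose nb (ib : 'I_n * bool) := upd x ib.1 (if ib.2 then dg x ib.1 + 1 else dg x ib.1 - 1).
have nbx ib : dg (nb ib) ib.1 != dg x ib.1.
  rewrite dg_upd eqxx; case: ib.2; last rewrite -[X in _ != X]subr0 (inj_eq (addrI _)).
    by rewrite -[X in _ != X]addr0 (inj_eq (addrI _)).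
  by [].
have -> : [set y | adj x y] = [set nb ib | ib : 'I_n * bool].
  apply/setP => y; rewrite inE; apply/idP/imsetP => [/adjP[i yi ->]|[ib _ ->]]; last first.
    by apply: adj_upd; have := nbx ib; rewrite dg_upd eqxx.
  exists (i, dg y i == dg x i + 1) => //; rewrite /nb /=; congr upd.
  case: eqVneq => // h; move: yi h.
  move: (dg y i) (dg x i) => [[|[|[|//]]] ?] [[|[|[|//]]] ?] //= _ _; exact: val_inj.
rewrite card_imset; first by rewrite card_prod card_ord card_bool mulnC.
move=> -[i b] [j c] E.
have ij : i = j.
  apply: contraTeq (nbx (i, b)) => ij; rewrite E dg_upd /= (negPf ij).
  by rewrite eqxx.
subst j; congr pair; move: (congr1 (fun z => dg z i) E); rewrite !dg_upd eqxx /=.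
by case: b {E}; case: c => // /addrI.
Qed.

Lemma subcube_refl u t : u \in subcube u t.
Proof. by rewrite inE; apply/forallP => i; rewrite eqxx orbT. Qed.

Lemma subcubeP u t x :
  reflect (forall i, i \notin t -> dg x i = dg u i) (x \in subcube u t).
Proof.
rewrite inE; apply: (iffP forallP) => h i.
  by move=> it; have := h i; rewrite (negPf it) => /eqP.
by case: (boolP (i \in t)) => //= it; rewrite h.
Qed.

Lemma subcubeS u t t' : {subset t <= t'} -> subcube u t \subset subcube u t'.
Proof.
move=> tt'; apply/subsetP => x /subcubeP h; apply/subcubeP => i it'.
by apply: h; apply: contra it'; apply: tt'.
Qed.

(** Only an upper bound, because the list [t] may repeat directions. *)
Lemma card_subcube u t : (#|subcube u t| <= 3 ^ size t)%N.
Proof.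
have -> : #|subcube u t| =
    #|family (fun i => if i \in t then predT else pred1 (dg u i))|.
  rewrite -(card_imset _ (can_inj dgK)); apply: eq_card => f.
  apply/imsetP/familyP => [[x /subcubeP xu ->] i|h].
    by case: ifP => // /negbT /xu ->; rewrite inE.
  exists (ug f); rewrite ?ugK //; apply/subcubeP => i it; rewrite ugK.
  by have := h i; rewrite (negPf it) inE => /eqP.
rewrite card_family foldrE big_map big_enum /=.
rewrite (eq_bigr (fun i => if i \in t then 3 else 1)%N); last first.
  by move=> i _; case: (i \in t); rewrite ?card1 // cardE -cardE card_ord.
rewrite -big_mkcond /= prod_nat_const leq_pexp2l //.
apply: leq_trans (card_size t); apply: subset_leq_card; exact/subsetP.
Qed.

(** Induction on the Hamming distance: correcting one digit of [x] to that of [y] is a step along an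
    open edge and does not leave the subcube. *)
Lemma subcube_connect (F : {set {set V}}) u t :
  {in subcube u t &, forall x y, adj x y -> [set x; y] \in F} ->
  {in subcube u t &, forall x y, connect [rel a b | [set a; b] \in F] x y}.
Proof.
move=> hF x y; have [k] := ubnP #|[set i | dg x i != dg y i]|.
elim: k x => // k IH x; rewrite ltnS => hk xu yu.
have [E|/set0Pn[i]] := eqVneq [set i | dg x i != dg y i] set0.
  rewrite (_ : y = x) ?connect0 //; apply: dg_ext => i.
  by move/setP: E => /(_ i); rewrite !inE => /negbFE/eqP.
rewrite inE => xyi; pose z := upd x i (dg y i).
have zu : z \in subcube u t.
  apply/subcubeP => j jt; rewrite dg_upd; case: eqP => [<-|_].
    exact: (subcubeP _ _ _ yu).
  exact: (subcubeP _ _ _ xu).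
apply: (connect_trans (y := z)).
  by apply: connect1 => /=; apply: hF => //; apply: adj_upd; rewrite eq_sym.
apply: IH => //; apply: leq_trans hk; apply: proper_card; apply/properP; split.
  by apply/subsetP => j; rewrite !inE dg_upd; case: (j =P i) => [->|//]; rewrite eqxx.
by exists i; rewrite !inE ?dg_upd ?eqxx.
Qed.

(** Vertices are added one at a time along an open edge leaving the current set; each such edge
    contributes a single new direction. *)
Lemma component_grow (F : {set {set V}}) x k : F \subset edges adj -> (k < #|component F x|)%N ->
  exists (S : {set V}) (t : seq 'I_n),
    [/\ size t = k, #|S| = k.+1, S \subset component F x & S \subset subcube x t].
Proof.
(* The induction also maintains [x \in S], so that a path from [x] to a component vertex outside [S]
   has to cross out of [S]. *)
move=> sF; suff: (k < #|component F x|)%N ->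
  exists (S : {set V}) (t : seq 'I_n), [/\ size t = k, #|S| = k.+1,
    S \subset component F x, S \subset subcube x t & x \in S].
  by move=> h /h[S [t [? ? ? ? _]]]; exists S, t.
elim: k => [_|k IH hk].
  exists [set x], [::]; rewrite cards1 !sub1set !inE eqxx connect0.
  by split=> //; apply/forallP => i; rewrite eqxx orbT.
have [S [t [tk Sk SC St xS]]] := IH (ltnW hk).
have /properP[_ [y yC yS]] : S \proper component F x by rewrite properEcard SC Sk.
move: (yC); rewrite inE => xy.
have [a [b [aS bS /= ab]]] := connect_crossing xy xS yS.
have abadj : adj a b.
  by rewrite -(in_edges cube_sym cube_irr); apply: (subsetP sF).
have [i _ bE] := adjP abadj.
exists (b |: S), (i :: t); split.
- by rewrite /= tk.
- by rewrite cardsU1 bS Sk.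
- rewrite subUset SC sub1set inE andbT.
  have := subsetP SC _ aS; rewrite inE => xa; apply: (connect_trans xa).
  exact: connect1.
- rewrite subUset sub1set (subset_trans St) ?andbT; last first.
    by apply: subcubeS => j jt; rewrite inE jt orbT.
  apply/subcubeP => j; rewrite inE negb_or => /andP[ji jt].
  by rewrite bE dg_upd (negPf ji); apply: (subcubeP _ _ _ (subsetP St _ aS)).
- by rewrite inE xS orbT.
Qed.

End Cube.

(** * Linking two vertex sets through many directions *)

Section Linking.
Variables (n : nat) (V : finType).
Variables (dg : V -> {ffun 'I_n -> 'I_3}) (ug : {ffun 'I_n -> 'I_3} -> V).
Hypotheses (dgK : cancel dg ug) (ugK : cancel ug dg).
Variable adj : rel V.
Hypothesis adjE : forall x y, adj x y = (#|[set i | dg x i != dg y i]| == 1%N).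
Variables (u : V) (t I1 I2 : seq 'I_n).
Hypotheses (t_I1 : {in I1, forall i, i \notin t}) (t_I2 : {in I2, forall i, i \notin t}).
Hypotheses (I12 : {in I1, forall i, i \notin I2}) (uniq1 : uniq I1) (uniq2 : uniq I2).

Notation upd := (upd dg ug).
Notation subcube := (subcube dg).
Let dg_upd := dg_upd ugK.
Let adj_upd := adj_upd ugK adjE.
Let in_edges x y : ([set x; y] \in edges adj) = adj x y :=
  in_edges (cube_sym adjE) (cube_irr adjE) x y.

(** The target digit depends on [u] and not on [x], so for [i] outside [t] the subcube at [u] moves
    as a whole to one parallel copy. *)
Definition shift (i : 'I_n) (x : V) : V := upd x i (dg u i + 1).

Definition spokes (i : 'I_n) (S : {set V}) : {set {set V}} :=
  [set [set s; shift i s] | s in S].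

(** The last condition discards the edges whose ends both have the [j]-digit of [u]: these lie in
    the copy shifted along [i] only, and would be shared by all [j]. *)
Definition hub_edges (i j : 'I_n) : {set {set V}} :=
  [set e in edges adj | (e \subset subcube (shift i u) (j :: t)) &&
     [exists x in e, dg x j != dg u j]].

Definition hubless (i : 'I_n) (F : {set {set V}}) : bool :=
  all (fun j => ~~ (hub_edges i j \subset F)) I2.

(* A direction [i] that is not [useless] joins [S] to [T]: leave [S] along a
   spoke, move in some direction [j] of [I2], travel inside a translate of the
   subcube all of whose edges are open, and come back. *)
Definition useless (S T : {set V}) (i : 'I_n) (F : {set {set V}}) : bool :=
  [|| [disjoint spokes i S & F], [disjoint spokes i T & F] | hubless i F].

(** Common supports for the events attached to direction [i]. They are disjoint for distinct
    directions of [r]: an end that differs from [u] in direction [j] is excluded from the family of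
    every other [i]. *)
Definition edges_along (r : seq 'I_n) (i : 'I_n) : {set {set V}} :=
  [set e : {set V} | [exists x in e, dg x i != dg u i] &&
     [forall x in e, all (fun k => (k == i) || (dg x k == dg u k)) r]].

Lemma edges_along_disjoint r i j : j \in r -> i != j -> [disjoint edges_along r i & edges_along r j].
Proof.
move=> jr ij; rewrite -setI_eq0 -subset0; apply/subsetP => e; rewrite !inE.
move=> /andP[/andP[_ /forallP h] /andP[/existsP[x /andP[xe xj]] _]].
have := h x; rewrite xe => /allP/(_ _ jr).
by rewrite eq_sym (negPf ij) (negPf xj).
Qed.

Lemma shift_neq i x : i \notin t -> x \in subcube u t -> dg u i + 1 != dg x i.
Proof.
move=> it /subcubeP -> //; rewrite -[X in _ != X]addr0 (inj_eq (addrI _)) //.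
Qed.

Lemma shift_subcube i x y s : x \in subcube y s -> shift i x \in subcube (shift i y) s.
Proof.
move=> /subcubeP h; apply/subcubeP => k ks; rewrite !dg_upd.
by case: eqP => // _; apply: h.
Qed.

Lemma spokes_edges i (S : {set V}) : i \notin t -> S \subset subcube u t ->
  spokes i S \subset edges adj.
Proof.
move=> it St; apply/subsetP => _ /imsetP[s /(subsetP St) su ->].
by rewrite in_edges; apply: adj_upd; apply: shift_neq.
Qed.

Lemma card_spokes i (S : {set V}) : i \notin t -> S \subset subcube u t ->
  #|spokes i S| = #|S|.
Proof.
move=> it St; apply: card_in_imset => x y xS yS E.
have := set21 x (shift i x); rewrite E !inE => /orP[/eqP //|/eqP xy].
have := shift_neq it (subsetP St _ xS); rewrite [in dg x]xy.
by rewrite dg_upd eqxx eqxx.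
Qed.

Lemma spokes_along i (S : {set V}) : i \in I1 -> S \subset subcube u t ->
  spokes i S \subset edges_along I1 i.
Proof.
move=> iI St; have it := t_I1 iI.
apply/subsetP => _ /imsetP[s /(subsetP St) su ->]; rewrite inE; apply/andP; split.
  apply/existsP; exists (shift i s); rewrite set22 dg_upd eqxx.
  exact: shift_neq (subcube_refl _ _ _).
apply/forallP => x; apply/implyP; rewrite !inE => /orP[]/eqP ->; apply/allP => k kI.
  by rewrite (subcubeP _ _ _ _ su) ?eqxx ?orbT // t_I1.
rewrite dg_upd; case: eqP => //= _.
by rewrite (subcubeP _ _ _ _ su) // t_I1.
Qed.

(** Every end of a hub edge carries the shifted digit in direction [i] and agrees with [u] on the
    rest of [I1]. This gives independence between different [i]. *)
Lemma hub_edges_along1 i j : i \in I1 -> j \in I2 -> hub_edges i j \subset edges_along I1 i.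
Proof.
move=> iI jI; apply/subsetP => e; rewrite !inE => /andP[_ /andP[/subsetP eW /existsP[y /andP[ye _]]]].
have jt k : k \in I1 -> k \notin j :: t.
  move=> kI; rewrite inE negb_or t_I1 // andbT.
  by apply: contraTneq jI => <-; apply: I12.
apply/andP; split.
  apply/existsP; exists y; rewrite ye (subcubeP _ _ _ _ (eW _ ye)) ?jt //.
  by rewrite dg_upd eqxx; apply: shift_neq; rewrite ?t_I1 ?subcube_refl.
apply/forallP => x; apply/implyP => xe; apply/allP => k kI.
rewrite (subcubeP _ _ _ _ (eW _ xe)) ?jt // dg_upd.
by case: (k == i); rewrite /= ?eqxx.
Qed.

(** The counterpart that, for fixed [i], gives independence between different [j]. *)
Lemma hub_edges_along2 i j : i \in I1 -> j \in I2 -> hub_edges i j \subset edges_along I2 j.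
Proof.
move=> iI jI; apply/subsetP => e; rewrite !inE => /andP[_ /andP[/subsetP eW ->]] /=.
apply/forallP => x; apply/implyP => xe; apply/allP => k kI.
have [//|kj /=] := eqVneq k j.
rewrite (subcubeP _ _ _ _ (eW _ xe)) ?inE ?negb_or ?kj ?t_I2 // dg_upd.
by case: (k =P i) kI => [-> |/=]; rewrite ?eqxx // (negPf (I12 iI)).
Qed.

(** Edges are counted crudely as arbitrary subsets of the subcube; what matters is that the bound
    does not involve [n]. *)
Lemma card_hub_edges i j : (#|hub_edges i j| <= 2 ^ 3 ^ (size t).+1)%N.
Proof.
have s : hub_edges i j \subset powerset (subcube (shift i u) (j :: t)).
  by apply/subsetP => e; rewrite !inE => /andP[_ /andP[]].
apply: leq_trans (subset_leq_card s) _; rewrite card_powerset leq_pexp2l //.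
exact: (card_subcube dgK ugK).
Qed.

Lemma useful_connect (S T : {set V}) i (F : {set {set V}}) :
  i \in I1 -> S \subset subcube u t -> T \subset subcube u t -> ~~ useless S T i F ->
  exists x y, [/\ x \in S, y \in T & connect [rel a b | [set a; b] \in F] x y].
Proof.
move=> iI St Tt; rewrite /useless !negb_or => /and3P[].
rewrite -!setI_eq0 => /set0Pn[e /setIP[/imsetP[x xS ->] xF]].
move=> /set0Pn[f /setIP[/imsetP[y yT ->] yF]].
rewrite -has_predC => /hasP[j jI /= /negbNE/subsetP hF].
have ij : i != j by apply: contraTneq jI => <-; apply: I12.
have [xu yu] : x \in subcube u t /\ y \in subcube u t by rewrite (subsetP St) ?(subsetP Tt).
exists x, y; split => //.
have csym := connect_sym_subgraph F.
(* The step from the copy shifted along [i] to the one shifted along [i] and [j] is a hub edge, its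
   far end differing from [u] in direction [j]. *)
have up z : z \in subcube u t ->
    connect [rel a b | [set a; b] \in F] (shift i z) (shift j (shift i z)).
  move=> zu; apply: connect1 => /=; apply: hF; rewrite in_set in_edges.
  have jz : dg u j + 1 != dg (shift i z) j.
    rewrite dg_upd (eq_sym j) (negPf ij); apply: shift_neq => //; exact: t_I2.
  rewrite adj_upd //=; apply/andP; split.
    have zi := shift_subcube i zu.
    rewrite subUset !sub1set; apply/andP; split.
      by apply: (subsetP (subcubeS _ _ _) _ zi) => k kt; rewrite inE kt orbT.
    apply/subcubeP => k; rewrite inE negb_or => /andP[kj kt].
    by rewrite dg_upd (negPf kj); apply: (subcubeP _ _ _ _ zi).
  apply/existsP; exists (shift j (shift i z)); rewrite set22 dg_upd eqxx.
  exact: shift_neq (t_I2 jI) (subcube_refl _ _ _).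
apply: (connect_trans (connect1 (xF : [rel a b | [set a; b] \in F] x (shift i x)))).
apply: (connect_trans (up _ xu)).
rewrite csym.
apply: (connect_trans (connect1 (yF : [rel a b | [set a; b] \in F] y (shift i y)))).
apply: (connect_trans (up _ yu)).
(* Both points now lie in the doubly shifted copy, all of whose edges belong to the hub. *)
apply: (subcube_connect dgK ugK adjE (u := shift j (shift i u)) (t := t)); last 2 first.
- by do 2!apply: shift_subcube.
- by do 2!apply: shift_subcube.
move=> a b aW bW ab; apply: hF; rewrite in_set in_edges ab /=; apply/andP; split.
  have sW z : z \in subcube (shift j (shift i u)) t -> z \in subcube (shift i u) (j :: t).
    move=> zW; apply/subcubeP => k; rewrite inE negb_or => /andP[kj kt].
    by rewrite (subcubeP _ _ _ _ zW) // dg_upd (negPf kj).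
  by rewrite subUset !sub1set !sW.
apply/existsP; exists a; rewrite set21 (subcubeP _ _ _ _ aW) ?t_I2 // dg_upd eqxx.
exact: shift_neq (t_I2 jI) (subcube_refl _ _ _).
Qed.

Variables (R : realType) (p : R).
Hypothesis p01 : 0 <= p <= 1.
Notation prob := (prob (edges adj) p).

(** The hubs of distinct [j] are disjoint, and each is fully open with probability bounded below
    independently of [n]. *)
Lemma prob_hubless i : i \in I1 ->
  prob (hubless i) <= (1 - p ^+ (2 ^ 3 ^ (size t).+1)) ^+ size I2.
Proof.
move=> iI; rewrite /hubless.
rewrite (@prob_all _ _ _ _ _ _ (fun j F => ~~ (hub_edges i j \subset F)) (hub_edges i)) //.
- elim: I2 => [|j r IH]; first by rewrite big_nil expr0.
  rewrite big_cons exprS; apply: ler_pM => //.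
  + exact: prob_ge0.
  + by apply: prodr_ge0 => k _; exact: prob_ge0.
  rewrite (prob_predC _ _ [pred F : {set {set V}} | hub_edges i j \subset F]).
  rewrite prob_all_open; last by apply/subsetP => e; rewrite in_set => /andP[].
  rewrite lerB //; case/andP: p01 => p0 p1.
  by apply: ler_wiXn2l => //; exact: card_hub_edges.
- by move=> j jI; apply/supported_predC/supported_open.
- move=> j k jI kI jk; apply: disjointWl (hub_edges_along2 iI jI) _.
  apply: disjointWr (hub_edges_along2 iI kI) _.
  exact: edges_along_disjoint.
Qed.

Lemma prob_useless (S T : {set V}) i k : i \in I1 ->
  S \subset subcube u t -> T \subset subcube u t -> #|S| = k -> #|T| = k ->
  prob (useless S T i) <=
    (1 - p) ^+ k *+ 2 + (1 - p ^+ (2 ^ 3 ^ (size t).+1)) ^+ size I2.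
Proof.
move=> iI St Tt Sk Tk; have it := t_I1 iI.
apply: (le_trans (prob_predU _ p01 [pred F : {set {set V}} | [disjoint spokes i S & F]]
  [pred F : {set {set V}} | [disjoint spokes i T & F] || hubless i F])).
rewrite mulr2n -addrA; apply: lerD.
  by rewrite prob_all_closed ?spokes_edges // card_spokes // Sk.
apply: (le_trans (prob_predU _ p01 [pred F : {set {set V}} | [disjoint spokes i T & F]]
  (hubless i))).
apply: lerD; last exact: prob_hubless.
by rewrite prob_all_closed ?spokes_edges // card_spokes // Tk.
Qed.

Lemma supported_useless (S T : {set V}) i : i \in I1 ->
  S \subset subcube u t -> T \subset subcube u t ->
  supported (useless S T i) (edges_along I1 i).
Proof.
move=> iI St Tt F G FG; rewrite /useless.
have sS := supportedS (spokes_along iI St) (@supported_closed _ (spokes i S)).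
have sT := supportedS (spokes_along iI Tt) (@supported_closed _ (spokes i T)).
have /= -> := sS F G FG.
have /= -> := sT F G FG.
congr [|| _, _ | _]; apply: eq_in_all => j jI.
have sH := supportedS (hub_edges_along1 iI jI) (@supported_open _ (hub_edges i j)).
by have /= -> := sH F G FG.
Qed.

Lemma prob_all_useless (S T : {set V}) k :
  S \subset subcube u t -> T \subset subcube u t -> #|S| = k -> #|T| = k ->
  prob [pred F | all (fun i => useless S T i F) I1] <=
    ((1 - p) ^+ k *+ 2 + (1 - p ^+ (2 ^ 3 ^ (size t).+1)) ^+ size I2) ^+ size I1.
Proof.
move=> St Tt Sk Tk.
rewrite (@prob_all _ _ _ _ _ _ (useless S T) (edges_along I1)) //; last 2 first.
- by move=> i iI; exact: supported_useless.
- by move=> i j _ jI; exact: edges_along_disjoint.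
rewrite -iter_mulr_1 -count_predT -big_const_seq big_seq [leRHS]big_seq.
apply: ler_prod => i iI; rewrite prob_ge0 //=; exact: prob_useless.
Qed.

End Linking.

(** * Disconnected graphs without isolated vertices *)

Lemma prob_exists_le (R : realType) (T I : finType) (E : {set T}) (p : R)
    (C : pred I) (A : I -> pred {set T}) (c : nat) (B : R) :
  0 <= p <= 1 -> (#|C| <= c)%N -> 0 <= B -> (forall i, C i -> prob E p (A i) <= B) ->
  prob E p [pred F | [exists (i | C i), A i F]] <= c%:R * B.
Proof.
move=> p01 Cc B0 AB; apply: le_trans (prob_exists _ p01 _ _) _.
apply: (@le_trans _ _ (\sum_(i | C i) B)); first exact: ler_sum.
by rewrite sumr_const -[leLHS]mulr_natl ler_wpM2r // ler_nat.
Qed.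

Section Gap.
Variables (n : nat) (V : finType).
Variables (dg : V -> {ffun 'I_n -> 'I_3}) (ug : {ffun 'I_n -> 'I_3} -> V).
Hypotheses (dgK : cancel dg ug) (ugK : cancel ug dg).
Variable adj : rel V.
Hypothesis adjE : forall x y, adj x y = (#|[set i | dg x i != dg y i]| == 1%N).
Hypothesis n_gt0 : (0 < n)%N.

Notation subcube := (subcube dg).
Let adj_sym := cube_sym adjE.
Let adj_irr := cube_irr adjE.

(** The lower half of the directions serves as [I1] and the upper half as [I2], both without the
    directions of the subcube. *)
Definition low_dirs (t : seq 'I_n) : seq 'I_n :=
  enum ([set i : 'I_n | (i < n./2)%N] :\: [set i in t]).

Definition high_dirs (t : seq 'I_n) : seq 'I_n :=
  enum ([set i : 'I_n | (n./2 <= i)%N] :\: [set i in t]).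

Lemma size_enum_setD (A : {set 'I_n}) (t : seq 'I_n) (f : 'I_(n./2) -> 'I_n) :
  injective f -> (forall i, f i \in A) -> (n./2 - size t <= size (enum (A :\: [set i in t])))%N.
Proof.
move=> finj fA; rewrite -cardE cardsD.
have h1 : (n./2 <= #|A|)%N.
  rewrite -[X in (X <= _)%N](card_ord n./2) -(card_imset _ finj).
  by apply/subset_leq_card/subsetP => _ /imsetP[i _ ->].
have h2 : (#|A :&: [set i in t]| <= size t)%N.
  apply: leq_trans (subset_leq_card (subsetIr _ _)) _.
  apply: leq_trans (card_size t); apply: subset_leq_card; apply/subsetP => i.
  by rewrite inE.
exact: leq_sub.
Qed.

Lemma size_low_dirs t : (n./2 - size t <= size (low_dirs t))%N.
Proof.
have le : (n./2 <= n)%N by lia.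
apply: (@size_enum_setD _ t (widen_ord le)).
  by move=> i j /(congr1 val) /= /val_inj.
by move=> i; rewrite inE /= ltn_ord.
Qed.

Lemma size_high_dirs t : (n./2 - size t <= size (high_dirs t))%N.
Proof.
have le : (n./2 <= n)%N by lia.
apply: (@size_enum_setD _ t (fun i => rev_ord (widen_ord le i))).
  by move=> i j /rev_ord_inj /(congr1 val) /= /val_inj.
by move=> i; rewrite inE /=; have := ltn_ord i; lia.
Qed.

Lemma component_gt1 (F : {set {set V}}) x : F \subset edges adj -> no_isolated F ->
  (1 < #|component F x|)%N.
Proof.
move=> sF /forallP/(_ x)/forallPn[e]; rewrite negb_imply negbK => /andP[eF xe].
have := subsetP sF _ eF; rewrite inE => /existsP[a /existsP[b /andP[ab /eqP E]]].
have anb : a != b by apply: contraTneq ab => ->; rewrite adj_irr.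
have c2 : #|e| = 2%N by rewrite E cards2 anb.
rewrite -[X in (X <= _)%N]c2; apply/subset_leq_card/subsetP => y ye; rewrite inE.
have [->|xy] := eqVneq x y; first exact: connect0.
apply: connect1 => /=; rewrite (_ : [set x; y] = e) //.
apply/eqP; rewrite eqEcard c2 cards2 xy andbT.
by rewrite subUset !sub1set xe ye.
Qed.

(** Tuples of fixed length form a finite type, as the union bounds require; padding with direction 0
    can only enlarge the subcube. *)
Lemma subcube_pad u (t : seq 'I_n) c : (size t <= c)%N ->
  exists t' : c.-tuple 'I_n, subcube u t \subset subcube u t'.
Proof.
move=> tc; have sz : size (t ++ nseq (c - size t) (Ordinal n_gt0)) == c.
  by rewrite size_cat size_nseq subnKC.
exists (Tuple sz); apply: subcubeS => i it /=.
by rewrite mem_cat it.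
Qed.

(** A small component is coded by a base vertex, [K] directions and a subset of the resulting
    subcube, which leaves only [#|V|] times a polynomial in [n] many choices. *)
Definition small_closed K (F : {set {set V}}) : bool :=
  [exists (u | xpredT u), exists (t | @predT (K.-tuple 'I_n) t),
    exists (S | (S \in powerset (subcube u t)) && (1 < #|S| <= K)%N),
    [disjoint boundary adj S & F]].

(** The length [(2 * K).+1] allows [K] directions for each of the two sets and one for the edge
    between their base vertices. *)
Definition unlinked K (F : {set {set V}}) : bool :=
  [exists (u | xpredT u), exists (t | @predT ((2 * K).+1.-tuple 'I_n) t),
    exists (S | (S \in powerset (subcube u t)) && (#|S| == K.+1)),
    exists (T | (T \in powerset (subcube u t)) && (#|T| == K.+1)),
    all (fun i => useless dg ug adj u t (high_dirs t) S T i F) (low_dirs t)].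

Lemma disconnected_cases K (F : {set {set V}}) : F \subset edges adj ->
  no_isolated F -> ~~ connected_graph F -> small_closed K F || unlinked K F.
Proof.
move=> sF niF /forallPn[x /forallPn[y xy]].
(* The full cube is connected, so a path in it from [x] to [y] leaves the component of [x] across
   some edge. *)
have [u [v [xu xv uv]]] : exists u v, [/\ u \in component F x, v \notin component F x & adj u v].
  have Qxy : connect adj x y.
    have full z : z \in subcube x (enum 'I_n).
      by apply/subcubeP => i; rewrite mem_enum.
    have := subcube_connect dgK ugK adjE (F := edges adj) (u := x) (t := enum 'I_n).
    move=> /(_ _ x y (full x) (full y)) h.
    rewrite -(_ : connect [rel a b | [set a; b] \in edges adj] x y = connect adj x y).
      by apply: h => a b _ _ ab; rewrite in_edges.
    by apply: eq_connect => a b /=; rewrite in_edges.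
  by apply: (connect_crossing Qxy); rewrite inE ?connect0.
have [small|/existsPn big] := boolP [exists w, #|component F w| <= K]%N.
  apply/orP; left; have /existsP[w cw] := small.
  have cw1 := component_gt1 w sF niF.
  (* With this value of [k] the set returned has as many vertices as the component, hence is all of
     it. *)
  have [|S [t [tk Sk SC St]]] := @component_grow _ _ _ _ dgK ugK _ adjE F w #|component F w|.-1 sF.
    by case: #|_| cw1.
  have SE : S = component F w.
    by apply/eqP; rewrite eqEcard SC Sk /=; case: #|_| cw1.
  have [|t' tt'] := @subcube_pad w t K.
    by rewrite tk; lia.
  apply/existsP; exists w => /=; apply/existsP; exists t' => /=.
  apply/existsP; exists S; rewrite powersetE (subset_trans St) //= SE cw1 cw /=.
  exact: closed_component.
apply/orP; right.
have grow w : exists (S : {set V}) (t : seq 'I_n),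
    [/\ size t = K, #|S| = K.+1, S \subset component F w & S \subset subcube w t].
  by apply: (component_grow dgK ugK adjE) => //; rewrite ltnNge.
have [S [s [sK SK SC Ss]]] := grow u.
have [T [t [tK TK TC Tt]]] := grow v.
have [i _ vE] := adjP dgK ugK adjE uv.
have sz : size (i :: s ++ t) == (2 * K).+1 by rewrite /= size_cat sK tK mulSn mul1n.
apply/existsP; exists u => /=; apply/existsP; exists (Tuple sz) => /=.
have Su : S \subset subcube u (i :: s ++ t).
  apply: subset_trans Ss _; apply: subcubeS => j js.
  by rewrite inE mem_cat js orbT.
have Tu : T \subset subcube u (i :: s ++ t).
  apply: subset_trans Tt _; apply/subsetP => z /subcubeP zv; apply/subcubeP => k.
  rewrite inE mem_cat !negb_or => /and3P[ki ks kt].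
  by rewrite zv // vE dg_upd // (negPf ki).
apply/existsP; exists S; rewrite powersetE Su SK eqxx /=.
apply/existsP; exists T; rewrite powersetE Tu TK eqxx /=.
(* A single direction that is not useless would put [u] and [v] in the same component. *)
apply/allP => k kl; apply: contraT => useful.
have [||a [b [aS bT ab]]] :=
    useful_connect dgK ugK adjE (t := i :: s ++ t) (I1 := low_dirs (i :: s ++ t)) _ _ kl Su Tu useful.
- by move=> j; rewrite mem_enum !inE => /andP[].
- by move=> j; rewrite !mem_enum !inE => /andP[_ jl]; rewrite leqNgt jl andbF.
have csym := connect_sym_subgraph F.
have := subsetP SC _ aS; rewrite inE => ua.
have := subsetP TC _ bT; rewrite inE csym => bv.
move: xu xv; rewrite !inE => xu /negP[].
exact: connect_trans (connect_trans xu ua) (connect_trans ab bv).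
Qed.

Variables (R : realType) (p : R).
Hypothesis p01 : 0 <= p <= 1.
Notation prob := (prob (edges adj) p).

Let q01 : 0 <= 1 - p <= 1.
Proof. by case/andP: p01 => p0 p1; rewrite subr_ge0 p1 gerBl p0. Qed.

Lemma prob_boundary_closed (S : {set V}) k : (k <= #|boundary adj S|)%N ->
  prob [pred F : {set {set V}} | [disjoint boundary adj S & F]] <= (1 - p) ^+ k.
Proof.
move=> kS; rewrite prob_all_closed ?boundary_edges //.
by case/andP: q01 => q0 q1; apply: ler_wiXn2l.
Qed.

Lemma prob_small_closed K : (K <= 2 * n)%N ->
  prob (small_closed K) <=
    #|V|%:R * ((n ^ K)%:R * ((2 ^ 3 ^ K)%:R * (1 - p) ^+ (2 * (2 * n - K)))).
Proof.
move=> Kn; have q0 k : 0 <= (1 - p) ^+ k by case/andP: q01 => ? _; apply: exprn_ge0.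
apply: prob_exists_le => // [|u _]; first by rewrite !mulr_ge0.
apply: prob_exists_le => // [||t _]; [|by rewrite !mulr_ge0|].
  by rewrite card_tuple card_ord.
apply: prob_exists_le => // [|S /andP[_ /andP[S1 SK]]].
  apply: leq_trans (_ : #|powerset (subcube u t)| <= _)%N.
    by apply/subset_leq_card/subsetP => S /andP[].
  rewrite card_powerset leq_pexp2l // -[X in (3 ^ X)%N](size_tuple t).
  exact: (card_subcube dgK ugK).
apply: prob_boundary_closed.
(* For 2 <= k <= K, both factors of k (2n - k) are at least those of 2 (2n - K). *)
apply: leq_trans (card_boundary (card_nbr dgK ugK adjE) S); nia.
Qed.

(** Here [m] bounds the number of low and of high directions from below, and [r] bounds the failure
    probability of one direction. The two equal constant factors count the choices of [S] and
    [T]. *)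
Lemma prob_unlinked K (r : R) : let m := (n./2 - (2 * K).+1)%N in
  (1 - p) ^+ K.+1 *+ 2 + (1 - p ^+ (2 ^ 3 ^ (2 * K).+2)) ^+ m <= r -> r <= 1 ->
  prob (unlinked K) <= #|V|%:R * ((n ^ (2 * K).+1)%:R * ((2 ^ 3 ^ (2 * K).+1)%:R *
    ((2 ^ 3 ^ (2 * K).+1)%:R * r ^+ m))).
Proof.
move=> m hr r1; have q0 k : 0 <= (1 - p) ^+ k by case/andP: q01 => ? _; apply: exprn_ge0.
have pM k : 0 <= 1 - p ^+ k <= 1.
  by case/andP: p01 => p0 p1; rewrite subr_ge0 exprn_ile1 //= gerBl exprn_ge0.
have r0 : 0 <= r.
  by apply: le_trans hr; rewrite addr_ge0 ?mulrn_wge0 // exprn_ge0 //; case/andP: (pM (2 ^ 3 ^ (2 * K).+2)%N).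
have rX k : 0 <= r ^+ k by apply: exprn_ge0.
have cS u (t : (2 * K).+1.-tuple 'I_n) :
    (#|fun S : {set V} => (S \in powerset (subcube u t)) && (#|S| == K.+1)| <= 2 ^ 3 ^ (2 * K).+1)%N.
  apply: leq_trans (_ : #|powerset (subcube u t)| <= _)%N.
    by apply/subset_leq_card/subsetP => S /andP[].
  rewrite card_powerset leq_pexp2l // -[X in (3 ^ X)%N](size_tuple t).
  exact: (card_subcube dgK ugK).
apply: prob_exists_le => // [|u _]; first by rewrite !mulr_ge0.
apply: prob_exists_le => // [||t _]; [|by rewrite !mulr_ge0|].
  by rewrite card_tuple card_ord.
apply: prob_exists_le => // [|S /andP[]]; first by rewrite !mulr_ge0.
rewrite powersetE => Su /eqP SK.
apply: prob_exists_le => // T /andP[]; rewrite powersetE => Tu /eqP TK.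
apply: le_trans (prob_all_useless dgK ugK adjE _ _ _ _ _ p01 Su Tu SK TK) _.
- by move=> j; rewrite mem_enum !inE => /andP[].
- by move=> j; rewrite mem_enum !inE => /andP[].
- by move=> j; rewrite !mem_enum !inE => /andP[_ jl]; rewrite leqNgt jl andbF.
- exact: enum_uniq.
- exact: enum_uniq.
rewrite size_tuple.
have sl := size_low_dirs t; have sh := size_high_dirs t.
rewrite size_tuple -/m in sl sh.
apply: (@le_trans _ _ (r ^+ size (low_dirs t))); last exact: ler_wiXn2l.
have [b0 b1] := andP (pM (2 ^ 3 ^ (2 * K).+2)%N).
apply: lerXn2r; rewrite ?nnegrE //.
  by rewrite addr_ge0 ?mulrn_wge0 // exprn_ge0.
by apply: le_trans hr; rewrite lerD2l ler_wiXn2l.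
Qed.

Lemma connected_no_isolated (F : {set {set V}}) : F \subset edges adj ->
  connected_graph F -> no_isolated F.
Proof.
move=> sF /forallP cF; apply/forallP => x; apply/negP => iso.
pose y := upd dg ug x (Ordinal n_gt0) (dg x (Ordinal n_gt0) + 1).
have xy : adj x y.
  apply: (adj_upd ugK adjE); rewrite -[X in _ != X]addr0 (inj_eq (addrI _)) //.
have /forallP/(_ y) c := cF x.
have [||a [b [+ ax /= ab]]] := @connect_crossing _ _ [set x] _ _ c; rewrite ?set11 //.
  by rewrite inE; apply: contraTneq xy => ->; rewrite adj_irr.
rewrite inE => /eqP aE; subst a.
by have /forallP/(_ [set x; b]) := iso; rewrite ab set21.
Qed.

Lemma prob_no_isolated_gap : prob (@no_isolated V) =
  prob (@connected_graph V) + prob [pred F | no_isolated F && ~~ connected_graph F].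
Proof.
rewrite {1}/prob (bigID (@connected_graph V)) /=; congr (_ + _).
apply: le_anti; rewrite (le_prob p01) /=; last by move=> F _ /andP[].
apply: (le_prob p01) => F wF cF /=.
by rewrite cF (connected_no_isolated (weight_subset wF) cF).
Qed.

Lemma prob_gap_le K : prob [pred F | no_isolated F && ~~ connected_graph F] <=
  prob (small_closed K) + prob (unlinked K).
Proof.
apply: le_trans (prob_predU _ p01 _ _); apply: (le_prob p01) => F wF /andP[niF ncF] /=.
exact: disconnected_cases (weight_subset wF) niF ncF.
Qed.

End Gap.

(** * Bonferroni inequalities *)

Lemma ffact_le_expn m k : (m ^_ k <= m ^ k)%N.
Proof. by elim: k => // k IH; rewrite ffactnSr expnSr leq_mul // leq_subr. Qed.

Lemma ffact_ge_expn m k : ((m - k) ^ k <= m ^_ k)%N.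
Proof.
suff h j : (j <= k)%N -> ((m - k) ^ j <= m ^_ j)%N by apply: h.
elim: j => // j IH jk; rewrite ffactnSr expnSr leq_mul ?IH ?(ltnW jk) //.
by rewrite leq_sub2l // ltnW.
Qed.

Lemma bin_le_expn m k : ('C(m, k) <= m ^ k)%N.
Proof.
apply: leq_trans (ffact_le_expn m k); rewrite -bin_ffact leq_pmulr //.
exact: fact_gt0.
Qed.

Section AlternatingBinomial.
Variable R : realType.

Definition alt_bin (X j : nat) : R := \sum_(k < j.+1) (-1) ^+ k * 'C(X, k)%:R.

Lemma alt_bin0 j : alt_bin 0 j = 1.
Proof.
rewrite /alt_bin big_ord_recl big1 ?addr0 ?mulr1 //= => i _.
by rewrite bin0n mulr0.
Qed.

(** Pascal's rule makes the sum telescope. The sign of the surviving term decides on which side of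
    the indicator of X = 0 the truncated sum lies. *)
Lemma alt_binS X j : alt_bin X.+1 j = (-1) ^+ j * 'C(X, j)%:R.
Proof.
elim: j => [|j IH]; first by rewrite /alt_bin big_ord1 !bin0.
rewrite /alt_bin big_ord_recr /= -/(alt_bin X.+1 j) IH binS natrD exprS.
by ring.
Qed.

Lemma alt_bin_even X m : (X == 0%N)%:R <= alt_bin X (2 * m).
Proof.
case: X => [|X]; first by rewrite alt_bin0.
by rewrite alt_binS exprM sqrrN !expr1n mul1r ler0n.
Qed.

Lemma alt_bin_odd X m : alt_bin X (2 * m).+1 <= (X == 0%N)%:R.
Proof.
case: X => [|X]; first by rewrite alt_bin0.
by rewrite alt_binS exprS exprM sqrrN !expr1n mulr1 mulN1r oppr_le0 ler0n.
Qed.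

End AlternatingBinomial.

Section Bonferroni.
Variables (V : finType) (adj : rel V) (r : nat).
Hypotheses (adj_sym : symmetric adj) (adj_irr : irreflexive adj).
Hypothesis regular : forall x, #|[set y | adj x y]| = r.
Notation N := #|V|.

Definition dependent_sets (k : nat) : {set {set V}} :=
  [set S : {set V} | (#|S| == k) && [exists x in S, exists y in S, adj x y]].

(** Choose a vertex, one of its [r] neighbours and the other k - 2 vertices freely. Multiplying by
    [N] avoids a division and the exponent k - 1. *)
Lemma card_dependent_sets k : (#|dependent_sets k| * N <= r * N ^ k)%N.
Proof.
have neq x y : adj x y -> x != y by apply: contraTneq => ->; rewrite adj_irr.
have ge2 (S : {set V}) x y : x \in S -> y \in S -> adj x y -> (1 < #|S|)%N.
  move=> xS yS /neq xy; have <- : #|[set x; y]| = 2%N by rewrite cards2 xy.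
  by apply: subset_leq_card; rewrite subUset !sub1set xS yS.
have [k2|k2] := ltnP k 2.
  rewrite (_ : dependent_sets k = set0) ?cards0 //; apply/setP => S; rewrite !inE.
  apply/negP => /andP[/eqP Sk /existsP[x /andP[xS /existsP[y /andP[yS xy]]]]].
  by have := ge2 S x y xS yS xy; rewrite Sk ltnNge -ltnS k2.
case: k k2 => [|[|k]] // _.
pose D := [set S : {set V} | #|S| == k].
have sub : dependent_sets k.+2 \subset
    \bigcup_(x in [set: V]) \bigcup_(y in [set y | adj x y]) [set x |: (y |: S) | S in D].
  apply/subsetP => S; rewrite inE => /andP[/eqP Sk].
  move=> /existsP[x /andP[xS /existsP[y /andP[yS xy]]]].
  apply/bigcupP; exists x; rewrite ?inE //; apply/bigcupP; exists y; rewrite ?inE //.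
  have yx : y \in S :\ x by rewrite !inE yS andbT eq_sym neq.
  apply/imsetP; exists (S :\ x :\ y); last by rewrite setD1K // setD1K.
  rewrite inE; apply/eqP; have := cardsD1 x S; have := cardsD1 y (S :\ x).
  by rewrite xS yx Sk; lia.
have bound : (#|dependent_sets k.+2| <= N * (r * 'C(N, k)))%N.
  apply: leq_trans (subset_leq_card sub) _.
  apply: (@leq_trans (\sum_(x in [set: V]) r * 'C(N, k))%N); last first.
    by rewrite sum_nat_const cardsT.
  apply: (big_ind2 (fun (A : {set {set V}}) k => #|A| <= k)%N).
  - by rewrite cards0.
  - by move=> A a B b hA hB; rewrite (leq_trans (leq_card_setU A B)) // leq_add.
  move=> x _; apply: (@leq_trans (\sum_(y in [set y | adj x y]) 'C(N, k))%N); last first.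
    by rewrite sum_nat_const regular.
  apply: (big_ind2 (fun (A : {set {set V}}) k => #|A| <= k)%N).
  - by rewrite cards0.
  - by move=> A a B b hA hB; rewrite (leq_trans (leq_card_setU A B)) // leq_add.
  by move=> y _; rewrite (leq_trans (leq_imset_card _ _)) // card_draws.
apply: leq_trans (leq_mul bound (leqnn N)) _.
by have := bin_le_expn N k; rewrite !expnS; nia.
Qed.

Variables (R : realType) (p : R).
Hypothesis p01 : 0 <= p <= 1.
Notation prob := (prob (edges adj) p).
Notation weight := (weight (edges adj) p).

Let q01 : 0 <= 1 - p <= 1.
Proof. by case/andP: p01 => p0 p1; rewrite subr_ge0 p1 gerBl p0. Qed.

(** The expectation of the binomial coefficient of X over k, for X the number of isolated vertices,
    written as a sum over the possible k-sets. *)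
Definition isolated_moment (k : nat) : R :=
  \sum_(S : {set V} | #|S| == k) (1 - p) ^+ #|touching adj S|.

Lemma isolated_momentE k :
  \sum_F weight F * 'C(#|[set v | isolated F v]|, k)%:R = isolated_moment k.
Proof.
pose I F := [set v : V | isolated F v].
transitivity (\sum_F \sum_(S : {set V} | #|S| == k) weight F * (S \subset I F)%:R).
  apply: eq_bigr => F _; rewrite -mulr_sumr -cards_draws; congr (_ * _).
  rewrite -sum1_card natr_sum [LHS]big_mkcond [RHS]big_mkcond /=.
  apply: eq_bigr => S _; rewrite inE -/(I F).
  by case: (#|S| == k); case: (S \subset I F).
rewrite exchange_big; apply: eq_bigr => S _ /=.
rewrite -[RHS](@prob_all_closed _ _ (edges adj)); last first.
  by apply/subsetP => e; rewrite in_set => /andP[].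
rewrite prob_indicator; apply: eq_bigr => F _.
have [->|wF] := eqVneq (weight F) 0; first by rewrite !mul0r.
by rewrite (isolated_subsetE _ (weight_subset wF)).
Qed.

Lemma prob_no_isolatedE :
  prob (@no_isolated V) = \sum_F weight F * (#|[set v | isolated F v]| == 0%N)%:R.
Proof.
rewrite prob_indicator; apply: eq_bigr => F _; congr (_ * _%:R); congr nat_of_bool.
rewrite cards_eq0; apply/forallP/eqP => [h|/setP h v].
  by apply/setP => v; rewrite !inE; apply: negbTE (h v).
by have := h v; rewrite !inE => ->.
Qed.

Lemma sum_moments j :
  \sum_(k < j.+1) (-1) ^+ k * isolated_moment k =
  \sum_F weight F * alt_bin R #|[set v | isolated F v]| j.
Proof.
under eq_bigr do rewrite -isolated_momentE mulr_sumr.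
rewrite exchange_big; apply: eq_bigr => F _ /=.
by rewrite mulr_sumr; apply: eq_bigr => k _; rewrite mulrCA.
Qed.

Lemma bonferroni_upper m :
  prob (@no_isolated V) <= \sum_(k < (2 * m).+1) (-1) ^+ k * isolated_moment k.
Proof.
rewrite sum_moments prob_no_isolatedE; apply: ler_sum => F _.
by rewrite ler_wpM2l ?weight_ge0 // alt_bin_even.
Qed.

Lemma bonferroni_lower m :
  \sum_(k < (2 * m).+2) (-1) ^+ k * isolated_moment k <= prob (@no_isolated V).
Proof.
rewrite sum_moments prob_no_isolatedE; apply: ler_sum => F _.
by rewrite ler_wpM2l ?weight_ge0 // alt_bin_odd.
Qed.

Lemma isolated_moment_ge k : 'C(N, k)%:R * (1 - p) ^+ (k * r) <= isolated_moment k.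
Proof.
rewrite -card_draws -sum1_card natr_sum mulr_suml.
rewrite [leLHS](eq_bigl (fun S : {set V} => #|S| == k)) => [|S]; last by rewrite inE.
apply: ler_sum => S /eqP Sk; rewrite mul1r.
case/andP: q01 => q0 q1; apply: ler_wiXn2l => //.
by rewrite -Sk; exact: card_touching.
Qed.

(** Touching edges are bounded below by the edges leaving the set: at least [k * r] for an
    independent set and [k * (r - k)] for any other. *)
Lemma isolated_moment_le k : isolated_moment k <=
  'C(N, k)%:R * (1 - p) ^+ (k * r) + #|dependent_sets k|%:R * (1 - p) ^+ (k * (r - k)).
Proof.
case/andP: q01 => q0 q1.
have qX j : 0 <= (1 - p) ^+ j by apply: exprn_ge0.
rewrite /isolated_moment (bigID (mem (dependent_sets k))) /= addrC; apply: lerD.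
  rewrite -card_draws -sum1_card natr_sum mulr_suml.
  rewrite [leRHS](eq_bigl (fun S : {set V} => #|S| == k)) => [|S]; last by rewrite inE.
  rewrite [leRHS](bigID (mem (dependent_sets k))) /= [leRHS]addrC.
  rewrite -[leLHS]addr0; apply: lerD; last by apply: sumr_ge0 => *; rewrite mulr_ge0.
  apply: ler_sum => S /andP[/eqP Sk indep]; rewrite mul1r.
  apply: ler_wiXn2l => //; rewrite -Sk.
  apply: leq_trans (subset_leq_card (boundary_touching adj_sym adj_irr S)).
  apply: card_boundary_indep => // x y xS yS; apply: contra indep => xy.
  rewrite inE Sk eqxx; apply/existsP; exists x; rewrite xS.
  by apply/existsP; exists y; rewrite yS.
rewrite -sum1_card natr_sum mulr_suml.
rewrite [leRHS](eq_bigl (fun S : {set V} => (#|S| == k) && (S \in dependent_sets k))).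
  apply: ler_sum => S /andP[/eqP Sk _]; rewrite mul1r; apply: ler_wiXn2l => //.
  apply: leq_trans (subset_leq_card (boundary_touching adj_sym adj_irr S)).
  by have := card_boundary regular S; rewrite Sk.
by move=> S; rewrite inE; case: eqP.
Qed.

End Bonferroni.

(** * Base-3 digits *)

Lemma digit3_inj n x y : (x < 3 ^ n)%N -> (y < 3 ^ n)%N ->
  (forall i, (i < n)%N -> digit3 x i = digit3 y i) -> x = y.
Proof.
elim: n x y => [|n IH] x y; first by rewrite expn0 !ltnS !leqn0 => /eqP -> /eqP ->.
rewrite expnS => xn yn E; rewrite (divn_eq x 3) (divn_eq y 3).
have := E 0%N isT; rewrite /digit3 !divn1 => ->; congr (_ * _ + _)%N.
apply: IH; rewrite ?ltn_divLR 1?mulnC // => i ni.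
by have := E i.+1 ni; rewrite /digit3 expnS !divnMA.
Qed.

Lemma cube3_digits n : exists (dg : 'I_(3 ^ n) -> {ffun 'I_n -> 'I_3}) ug,
  [/\ cancel dg ug, cancel ug dg &
      forall x y, @cube3_adj n x y = (#|[set i | dg x i != dg y i]| == 1%N)].
Proof.
pose dg (x : 'I_(3 ^ n)) := [ffun i : 'I_n => inord (digit3 x i) : 'I_3].
have dgE x y i : (dg x i == dg y i) = (digit3 x i == digit3 y i).
  by rewrite !ffunE -val_eqE /= !inordK ?ltn_pmod.
have dg_inj : injective dg.
  move=> x y /ffunP E; apply: val_inj; apply: (@digit3_inj n) => [||i ni]; [exact: ltn_ord..|].
  by apply/eqP; rewrite -(dgE x y (Ordinal ni)) E.
have [ug h1 h2] : bijective dg.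
  by apply: inj_card_bij => //; rewrite card_ffun !card_ord.
exists dg, ug; split => // x y; rewrite /cube3_adj; congr (_ == _).
by apply: eq_card => i; rewrite !inE dgE.
Qed.

(** * Transfer of the bounds to the 3-cube *)

Section Cube3.
Variables (R : realType) (n : nat) (p : R).
Hypotheses (p01 : 0 <= p <= 1) (n_gt0 : (0 < n)%N).
Notation adj := (@cube3_adj n).
Notation V := 'I_(3 ^ n).
Notation moment := (isolated_moment adj p).

Lemma cube3_regular (x : V) : #|[set y | adj x y]| = (2 * n)%N.
Proof. by have [dg [ug [dgK ugK adjE]]] := cube3_digits n; apply: (card_nbr dgK ugK). Qed.

Lemma cube3_moment_ge k : 'C(3 ^ n, k)%:R * (1 - p) ^+ (k * (2 * n)) <= moment k.
Proof.
rewrite -[X in 'C(X, k)](card_ord (3 ^ n)).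
exact: isolated_moment_ge (@cube3_adj_sym n) cube3_regular _ _ p01 k.
Qed.

Lemma cube3_moment_le k : moment k <=
  'C(3 ^ n, k)%:R * (1 - p) ^+ (k * (2 * n)) +
  #|dependent_sets adj k|%:R * (1 - p) ^+ (k * (2 * n - k)).
Proof.
rewrite -[X in 'C(X, k)](card_ord (3 ^ n)).
exact: isolated_moment_le (@cube3_adj_sym n) (@cube3_adj_irr n) cube3_regular _ _ p01 k.
Qed.

Lemma cube3_bonferroni_upper m :
  random_subgraph_prob adj p (@no_isolated V) <=
  \sum_(k < (2 * m).+1) (-1) ^+ k * moment k.
Proof. by rewrite random_subgraph_probE; apply: bonferroni_upper. Qed.

Lemma cube3_bonferroni_lower m :
  \sum_(k < (2 * m).+2) (-1) ^+ k * moment k <=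
  random_subgraph_prob adj p (@no_isolated V).
Proof. by rewrite random_subgraph_probE; apply: bonferroni_lower. Qed.

Lemma cube3_gap_ge0 :
  0 <= random_subgraph_prob adj p (@no_isolated V) -
       random_subgraph_prob adj p (@connected_graph V).
Proof.
have [dg [ug [dgK ugK adjE]]] := cube3_digits n.
rewrite !random_subgraph_probE (prob_no_isolated_gap ugK adjE n_gt0 p01).
by rewrite addrAC subrr add0r prob_ge0.
Qed.

Lemma cube3_gap_le K (r : R) : let d := (2 * K).+1 in let m := (n./2 - d)%N in
  (K <= 2 * n)%N ->
  (1 - p) ^+ K.+1 *+ 2 + (1 - p ^+ (2 ^ 3 ^ d.+1)) ^+ m <= r -> r <= 1 ->
  random_subgraph_prob adj p (@no_isolated V) -
    random_subgraph_prob adj p (@connected_graph V) <=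
  (3 ^ n)%:R * ((n ^ K)%:R * ((2 ^ 3 ^ K)%:R * (1 - p) ^+ (2 * (2 * n - K)))) +
  (3 ^ n)%:R * ((n ^ d)%:R * ((2 ^ 3 ^ d)%:R * ((2 ^ 3 ^ d)%:R * r ^+ m))).
Proof.
move=> d m Kn hr r1; have [dg [ug [dgK ugK adjE]]] := cube3_digits n.
rewrite !random_subgraph_probE (prob_no_isolated_gap ugK adjE n_gt0 p01).
rewrite addrAC subrr add0r.
apply: le_trans (prob_gap_le dgK ugK adjE n_gt0 p01 K) _; apply: lerD.
  by have := prob_small_closed dgK ugK adjE n_gt0 p01 Kn; rewrite card_ord.
by have := prob_unlinked dgK ugK adjE n_gt0 p01 hr r1; rewrite card_ord.
Qed.

End Cube3.

Lemma cube3_card_dependent_sets n k :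
  (#|dependent_sets (@cube3_adj n) k| * 3 ^ n <= (2 * n) * (3 ^ n) ^ k)%N.
Proof.
have := card_dependent_sets (@cube3_adj_irr n) (@cube3_regular n) k.
by rewrite card_ord.
Qed.

(** * Asymptotics *)

From mathcomp Require Import all_classical all_reals all_analysis.
Import Order.TTheory GRing.Theory Num.Theory.
Import numFieldNormedType.Exports.
Local Open Scope classical_set_scope.
Local Open Scope ring_scope.

Lemma bin_le_exp2 m k : ('C(m, k) <= 2 ^ m)%N.
Proof.
elim: m k => [|m IH] [|k] //; first by rewrite bin0 expn_gt0.
by rewrite binS expnS mul2n -addnn leq_add.
Qed.

(** The power n^c is at most the falling factorial of c + n of length c, which is c! times a
    binomial coefficient and so at most c! 2^(c+n). A geometric sequence of ratio 2/3 remains. *)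
Lemma cvg_expn_div3 (R : realType) (c : nat) :
  (fun n : nat => (n ^ c)%:R / 3 ^+ n : R) @ \oo --> (0 : R).
Proof.
apply: (@squeeze_cvgr _ _ _ _ (cst 0) (fun n => (c`! * 2 ^ c)%:R * (2 / 3) ^+ n)).
- near=> n; rewrite divr_ge0 ?ler0n ?exprn_ge0 //= expr_div_n mulrA ler_pM2r ?invr_gt0 ?exprn_gt0 //.
  rewrite -natrX -natrM ler_nat -mulnA -expnD.
  apply: (@leq_trans ((c + n) ^_ c)); first by rewrite -[X in (X ^ _ <= _)%N](addKn c) ffact_ge_expn.
  by rewrite -bin_ffact mulnC leq_mul // bin_le_exp2.
- exact: cvg_cst.
rewrite -[X in _ --> X](mulr0 (c`! * 2 ^ c)%:R); apply: cvgMr.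
by apply: cvg_expr; rewrite ger0_norm; lra.
Unshelve. all: by end_near. Qed.

Section Asymptotics.
Variables (R : realType) (lambda : R) (q : nat -> R).
Hypothesis lambda_gt0 : 0 < lambda.
Hypothesis q01 : forall n, (0 < n)%N -> 0 <= q n <= 1.

Definition mean (n : nat) : R := 3 ^+ n * q n ^+ (2 * n).

Hypothesis mean_cvg : mean n @[n --> \oo] --> lambda.

(** The constants 1/2 here and 3/5 below enclose 1 / sqrt 3. If q < 1/2 then 3 q^2 < 3/4, so the
    mean would be at most (3/4)^n, against its positive limit. *)
Lemma near_q_ge : \forall n \near \oo, 2^-1 <= q n.
Proof.
have c0 : (3 / 4 : R) ^+ n @[n --> \oo] --> (0 : R).
  by apply: cvg_expr; rewrite ger0_norm; lra.
have l2 : lambda / 2 < lambda by move: lambda_gt0; lra.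
have l3 : 0 < lambda / 2 by rewrite divr_gt0.
near=> n.
have n0 : (0 < n)%N by near: n; exact: nbhs_infty_gt.
have /andP[q0 q1] := q01 n0.
rewrite leNgt; apply/negP => qn.
have h1 : (3 / 4 : R) ^+ n < lambda / 2 by near: n; exact: (cvgr_lt _ c0).
have h2 : lambda / 2 < mean n by near: n; exact: (cvgr_gt _ mean_cvg).
suff : mean n <= (3 / 4) ^+ n by lra.
rewrite /mean exprM -exprMn; apply: lerXn2r; rewrite ?nnegrE; [|lra|].
  by rewrite mulr_ge0 ?exprn_ge0.
by rewrite expr2; nra.
Unshelve. all: by end_near. Qed.

(** If q > 3/5 then 3 q^2 > 27/25, and the mean would exceed every bound. *)
Lemma near_q_le : \forall n \near \oo, q n <= 3 / 5.
Proof.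
have c0 : (25 / 27 : R) ^+ n @[n --> \oo] --> (0 : R).
  by apply: cvg_expr; rewrite ger0_norm; lra.
have l2 : lambda < lambda + 1 by lra.
have l3 : 0 < (lambda + 1)^-1 by rewrite invr_gt0; move: lambda_gt0; lra.
near=> n.
have n0 : (0 < n)%N by near: n; exact: nbhs_infty_gt.
have /andP[q0 q1] := q01 n0.
rewrite leNgt; apply/negP => qn.
have h1 : (25 / 27 : R) ^+ n < (lambda + 1)^-1 by near: n; exact: (cvgr_lt _ c0).
have h2 : mean n < lambda + 1 by near: n; exact: (cvgr_lt _ mean_cvg).
have : 1 <= (25 / 27) ^+ n * mean n.
  rewrite /mean mulrA exprM -!exprMn; apply: exprn_ege1.
  by rewrite expr2; nra.
apply/negP; rewrite -ltNge.
have x0 : 0 < (25 / 27 : R) ^+ n by apply: exprn_gt0; lra.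
apply: (@lt_trans _ _ ((25 / 27) ^+ n * (lambda + 1))); first by rewrite ltr_pM2l.
by rewrite -(@ltr_pdivlMr _ (lambda + 1)) ?div1r // ; move: lambda_gt0; lra.
Unshelve. all: by end_near. Qed.

(** Since q >= 1/2, missing powers of q can be restored at a constant cost, which turns the
    exponents below into multiples of 2n and hence into powers of the mean. *)
Lemma near_expr_le j : \forall n \near \oo, forall i : nat,
  (0 < n)%N -> q n ^+ i <= 2 ^+ j * q n ^+ (i + j).
Proof.
near=> n => i n0.
have q2 : 2^-1 <= q n by near: n; exact: near_q_ge.
rewrite exprD mulrCA -exprMn ler_peMr ?exprn_ge0 //; first lra.
by apply: exprn_ege1; lra.
Unshelve. all: by end_near. Qed.

Lemma mean_sub_cvg k : (mean n - k%:R * q n ^+ (2 * n)) @[n --> \oo] --> lambda.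
Proof.
rewrite -[X in _ --> X]subr0; apply: cvgB => //.
rewrite -[X in _ --> X](mulr0 k%:R); apply: cvgMr.
(* The factor [n ^ 0] makes this an instance of [cvg_expn_div3]. *)
have -> : (fun n => q n ^+ (2 * n)) = (fun n => mean n * ((n ^ 0)%:R / 3 ^+ n)).
  apply/funext => n; rewrite /mean expn0 div1r mulrAC mulfV ?mul1r //.
rewrite -[X in _ --> X](mulr0 lambda); apply: cvgM => //.
exact: cvg_expn_div3.
Qed.

Lemma cvg_exprn (u : nat -> R) (l : R) k : u n @[n --> \oo] --> l ->
  u n ^+ k @[n --> \oo] --> l ^+ k.
Proof. by move=> ul; apply: (continuous_cvg _ (@exprn_continuous R k l) ul). Qed.

(** The falling factorial of N = 3^n of length k lies between (N - k)^k and N^k; multiplied by the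
    power of q, these become k-th powers of sequences tending to [lambda]. *)
Lemma moment_main_cvg k :
  ('C(3 ^ n, k)%:R * q n ^+ (k * (2 * n))) @[n --> \oo] --> lambda ^+ k / k`!%:R.
Proof.
apply: (@squeeze_cvgr _ _ _ _ (fun n => (mean n - k%:R * q n ^+ (2 * n)) ^+ k / k`!%:R)
  (fun n => mean n ^+ k / k`!%:R)).
- near=> n.
  have n0 : (0 < n)%N by near: n; exact: nbhs_infty_gt.
  have /andP[q0 q1] := q01 n0.
  have kn : (k <= 3 ^ n)%N.
    apply: leq_trans (ltnW (ltn_expl n (isT : 1 < 3)%N)).
    by near: n; exact: nbhs_infty_ge.
  have kf : 0 < k`!%:R :> R by rewrite ltr0n fact_gt0.
  have -> : 'C(3 ^ n, k)%:R * q n ^+ (k * (2 * n)) =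
      ((3 ^ n) ^_ k)%:R * (q n ^+ (2 * n)) ^+ k / k`!%:R.
    by rewrite -bin_ffact natrM -exprM [(k * _)%N]mulnC mulrAC mulfK ?gt_eqF.
  rewrite !ler_pM2r ?invr_gt0 // /mean -natrX -mulrBl -natrB // !exprMn -!natrX.
  rewrite !ler_wpM2r ?exprn_ge0 ?ler_nat ?ffact_le_expn ?ffact_ge_expn //.
- by apply: cvgMl; apply: cvg_exprn; exact: mean_sub_cvg.
- by apply: cvgMl; apply: cvg_exprn.
Unshelve. all: by end_near. Qed.

(** Up to a constant the term is at most n times the k-th power of the mean, divided by 3^n. *)
Lemma moment_error_cvg k (D : nat -> nat) :
  (forall n, (D n * 3 ^ n <= (2 * n) * (3 ^ n) ^ k)%N) ->
  ((D n)%:R * q n ^+ (k * (2 * n - k))) @[n --> \oo] --> (0 : R).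
Proof.
move=> hD.
apply: (@squeeze_cvgr _ _ _ _ (cst 0)
  (fun n => 2 ^+ (k * k) * 2 * mean n ^+ k * ((n ^ 1)%:R / 3 ^+ n))).
- near=> n.
  have n0 : (0 < n)%N by near: n; exact: nbhs_infty_gt.
  have /andP[q0 q1] := q01 n0.
  have kn : (k <= 2 * n)%N.
    apply: (@leq_trans n); last by rewrite leq_pmull.
    by near: n; exact: nbhs_infty_ge.
  rewrite mulr_ge0 ?exprn_ge0 //=.
  have qe : q n ^+ (k * (2 * n - k)) <= 2 ^+ (k * k) * q n ^+ (k * (2 * n - k) + k * k).
    by apply: (near (near_expr_le (k * k)) n).
  rewrite -mulnDr subnK // in qe.
  apply: le_trans (ler_wpM2l (ler0n _ _) qe) _.
  rewrite mulrCA -!mulrA ler_pM2l ?exprn_gt0 // /mean exprMn -(exprM (q n)) [(2 * n * k)%N]mulnC.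
  rewrite [leRHS](_ : _ = (2 * (3 ^+ n) ^+ k * (n ^ 1)%:R / 3 ^+ n) * q n ^+ (k * (2 * n))); last by ring.
  apply: ler_wpM2r; first exact: exprn_ge0.
  rewrite ler_pdivlMr ?exprn_gt0 // -!natrX -!natrM ler_nat expn1.
  by rewrite mulnAC; exact: hD.
- exact: cvg_cst.
rewrite -[X in _ --> X](mulr0 (2 ^+ (k * k) * 2 * lambda ^+ k)); apply: cvgM.
  by apply: cvgMr; exact: cvg_exprn.
exact: cvg_expn_div3.
Unshelve. all: by end_near. Qed.

Lemma small_closed_cvg K (C : R) :
  ((3 ^ n)%:R * ((n ^ K)%:R * (C * q n ^+ (2 * (2 * n - K))))) @[n --> \oo] --> (0 : R).
Proof.
rewrite -[X in _ --> X](mulr0 C).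
suff h : ((3 ^ n)%:R * (n ^ K)%:R * q n ^+ (2 * (2 * n - K))) @[n --> \oo] --> (0 : R).
  have -> : (fun n => (3 ^ n)%:R * ((n ^ K)%:R * (C * q n ^+ (2 * (2 * n - K))))) =
      (fun n => C * ((3 ^ n)%:R * (n ^ K)%:R * q n ^+ (2 * (2 * n - K)))).
    by apply/funext => n; ring.
  exact: cvgMr.
apply: (@squeeze_cvgr _ _ _ _ (cst 0)
  (fun n => 2 ^+ (2 * K) * mean n ^+ 2 * ((n ^ K)%:R / 3 ^+ n))).
- near=> n.
  have n0 : (0 < n)%N by near: n; exact: nbhs_infty_gt.
  have /andP[q0 q1] := q01 n0.
  have kn : (K <= 2 * n)%N.
    apply: (@leq_trans n); last by rewrite leq_pmull.
    by near: n; exact: nbhs_infty_ge.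
  rewrite !mulr_ge0 ?exprn_ge0 //=.
  have qe : q n ^+ (2 * (2 * n - K)) <= 2 ^+ (2 * K) * q n ^+ (2 * (2 * n - K) + 2 * K).
    by apply: (near (near_expr_le (2 * K)) n).
  rewrite -mulnDr subnK // in qe.
  apply: le_trans (ler_wpM2l _ qe) _; first by rewrite mulr_ge0.
  rewrite le_eqVlt; apply/orP; left; apply/eqP.
  rewrite /mean natrX exprMn -(exprM (q n)) [(2 * n * 2)%N]mulnC expr2.
  by field; rewrite expf_neq0.
- exact: cvg_cst.
rewrite -[X in _ --> X](mulr0 (2 ^+ (2 * K) * lambda ^+ 2)); apply: cvgM.
  by apply: cvgMr; exact: cvg_exprn.
exact: cvg_expn_div3.
Unshelve. all: by end_near. Qed.

End Asymptotics.

Lemma unlinked_cvg (R : realType) (d : nat) (C : R) :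
  ((3 ^ n)%:R * ((n ^ d)%:R * (C * (C * (3^-1 ^+ 6) ^+ (n./2 - d))))) @[n --> \oo]
    --> (0 : R).
Proof.
pose f (n : nat) : R := 3 ^+ n * (n ^ d)%:R * (3^-1 ^+ 6) ^+ (n./2 - d).
suff h : f n @[n --> \oo] --> (0 : R).
  have -> : (fun n => (3 ^ n)%:R * ((n ^ d)%:R * (C * (C * (3^-1 ^+ 6) ^+ (n./2 - d))))) =
      (fun n => C * C * f n).
    by apply/funext => n; rewrite /f natrX; ring.
  by rewrite -[X in _ --> X](mulr0 (C * C)); apply: cvgMr.
apply: (@squeeze_cvgr _ _ _ _ (cst 0)
  (fun n => 3 ^+ (6 * d + 3) * ((n ^ d)%:R / 3 ^+ n))).
- near=> n.
  have t0 : 0 <= 3^-1 :> R by rewrite invr_ge0.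
  rewrite !mulr_ge0 ?exprn_ge0 //=.
  (* Six times [n./2] is at least 3n - 3; the rounding and the [d] lost directions cost the constant
     in front. *)
  have h3 : (3^-1 ^+ 6) ^+ (n./2 - d) <= 3 ^+ (6 * d + 3) * (3^-1 : R) ^+ (3 * n).
    rewrite -exprM exprVn exprVn ler_pdivlMr ?exprn_gt0 // ler_pdivrMl ?exprn_gt0 //.
    by rewrite -exprD ler_weXn2l ?ler1n //; lia.
  apply: le_trans (ler_wpM2l _ h3) _; first by rewrite mulr_ge0 ?exprn_ge0.
  rewrite [leLHS](_ : _ = 3 ^+ (6 * d + 3) * ((n ^ d)%:R * (3 ^+ n * 3^-1 ^+ (3 * n)))); last by ring.
  rewrite !ler_wpM2l ?exprn_ge0 //.
  rewrite exprVn ler_pdivrMr ?exprn_gt0 // ler_pdivlMl ?exprn_gt0 //.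
  by rewrite -exprD ler_weXn2l ?ler1n //; lia.
- exact: cvg_cst.
by rewrite -[X in _ --> X](mulr0 (3 ^+ (6 * d + 3))); apply: cvgMr; exact: cvg_expn_div3.
Unshelve. all: by end_near. Qed.

(** The mean equals [lambda] times (1 + eps)^(2n), which Bernoulli's inequality and the exponential
    squeeze between 1 + 2 n eps and exp (2 n eps). *)
Lemma sqrt3_mean_cvg (R : realType) (lambda : R) (lambda_gt0 : 0 < lambda) (q eps : nat -> R)
    (eps_o : (fun n : nat => n%:R * eps n) @ \oo --> (0 : R))
    (qE : forall n : nat, (0 < n)%N ->
       q n = (Num.sqrt 3)^-1 * lambda `^ (1 / (2 * n%:R)) * (1 + eps n)) :
  mean q n @[n --> \oo] --> lambda.
Proof.
have bern (x : R) k : - 1 <= x -> 1 + k%:R * x <= (1 + x) ^+ k.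
  move=> x1; elim: k => [|k IH]; first by rewrite mul0r addr0.
  rewrite exprS; apply: le_trans (ler_wpM2l _ IH); last lra.
  have : 0 <= k%:R * x ^+ 2 by rewrite mulr_ge0 ?sqr_ge0.
  by rewrite -natr1 expr2; nra.
have meanE n : (0 < n)%N -> mean q n = lambda * (1 + eps n) ^+ (2 * n).
  move=> n0; rewrite /mean qE // !exprMn.
  have -> : (Num.sqrt (3 : R))^-1 ^+ (2 * n) = (3 ^+ n)^-1.
    by rewrite exprM exprVn sqr_sqrtr // exprVn.
  have -> : (lambda `^ (1 / (2 * n%:R))) ^+ (2 * n) = lambda.
    rewrite -powR_mulrn ?powR_ge0 // -powRrM natrM div1r mulVf ?powRr1 ?ltW //.
    by rewrite mulf_neq0 // pnatr_eq0 -lt0n.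
  by rewrite mulrA mulrA mulfV ?mul1r // expf_neq0.
have e2 : (2 * (n%:R * eps n)) @[n --> \oo] --> (0 : R).
  by rewrite -[X in _ --> X](mulr0 2); apply: cvgMr.
have h1 : (1 + eps n) ^+ (2 * n) @[n --> \oo] --> (1 : R).
  apply: (@squeeze_cvgr _ _ _ _ (fun n => 1 + 2 * (n%:R * eps n))
    (fun n => expR (2 * (n%:R * eps n)))).
  - near=> n.
    have n0 : (0 < n)%N by near: n; exact: nbhs_infty_gt.
    have en : - 1 <= eps n.
      have : `|0 - n%:R * eps n| < 1.
        near: n; by move/cvgrPdist_lt : eps_o; apply.
      rewrite sub0r normrN => /ltr_normlP[h _].
      have n1 : 1 <= n%:R :> R by rewrite ler1n.
      by nra.
    rewrite mulrA -natrM bern //= expRM_natl.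
    apply: lerXn2r; rewrite ?nnegrE ?expR_ge0 ?expR_ge1Dx //; lra.
  - by rewrite -[X in _ --> X]addr0; apply: cvgD => //; exact: cvg_cst.
  - rewrite -[X in _ --> X](expR0 R).
    exact: (continuous_cvg _ (@continuous_expR R 0) e2).
rewrite -[X in _ --> X]mulr1.
have h2 : lambda * (1 + eps n) ^+ (2 * n) @[n --> \oo] --> lambda * 1.
  exact: cvgMr.
apply: cvg_trans h2; apply: near_eq_cvg; near=> n.
by rewrite meanE //; near: n; exact: nbhs_infty_gt.
Unshelve. all: by end_near. Qed.

(** The truncation level is fixed first, bringing two consecutive partial sums of the exponential
    series close to the limit; only then does n grow, with finitely many terms to control. *)
Lemma cvg_alternating_exp (R : realType) (lambda : R) (f : nat -> R) (b : nat -> nat -> R) :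
  (forall k, b k n @[n --> \oo] --> lambda ^+ k / k`!%:R) ->
  (forall m, \forall n \near \oo, f n <= \sum_(k < (2 * m).+1) (-1) ^+ k * b k n) ->
  (forall m, \forall n \near \oo, \sum_(k < (2 * m).+2) (-1) ^+ k * b k n <= f n) ->
  f n @[n --> \oo] --> expR (- lambda).
Proof.
move=> bk fU fL.
pose s j : R := \sum_(k < j) (-1) ^+ k * (lambda ^+ k / k`!%:R).
have bs j : (\sum_(k < j) (-1) ^+ k * b k n) @[n --> \oo] --> s j.
  rewrite /s; elim: j => [|j IH].
    under eq_fun do rewrite big_ord0.
    rewrite big_ord0; exact: cvg_cst.
  under eq_fun do rewrite big_ord_recr /=.
  by rewrite big_ord_recr /=; apply: cvgD => //; apply: cvgMr.
have s_lim : s j @[j --> \oo] --> expR (- lambda).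
  have -> : s = series (exp_coeff (- lambda)).
    apply/funext => j; rewrite /series /= big_mkord; apply: eq_bigr => k _.
    by rewrite /exp_coeff /= [(- lambda) ^+ k]exprNn mulrA.
  exact: is_cvg_series_exp_coeff.
apply/cvgrPdist_le => e e0.
have e2 : 0 < e / 2 by rewrite divr_gt0.
move/cvgrPdist_lt : s_lim => /(_ _ e2)[M _ hM].
have hU : `|expR (- lambda) - s (2 * M).+1| < e / 2 by apply: hM => /=; lia.
have hL : `|expR (- lambda) - s (2 * M).+2| < e / 2 by apply: hM => /=; lia.
near=> n.
have bU : `|s (2 * M).+1 - \sum_(k < (2 * M).+1) (-1) ^+ k * b k n| < e / 2.
  near: n; by move/cvgrPdist_lt : (bs (2 * M).+1); apply.
have bL : `|s (2 * M).+2 - \sum_(k < (2 * M).+2) (-1) ^+ k * b k n| < e / 2.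
  near: n; by move/cvgrPdist_lt : (bs (2 * M).+2); apply.
have nU : f n <= \sum_(k < (2 * M).+1) (-1) ^+ k * b k n by near: n; exact: fU.
have nL : \sum_(k < (2 * M).+2) (-1) ^+ k * b k n <= f n by near: n; exact: fL.
move: hU hL bU bL; rewrite !ltr_norml => /andP[u1 u2] /andP[l1 l2] /andP[u3 u4] /andP[l3 l4].
rewrite ler_norml; apply/andP; split; lra.
Unshelve. all: by end_near. Qed.

(** * The limits, assuming that the mean converges *)

Section Limits.
Variables (R : realType) (lambda : R) (p : nat -> R).
Hypothesis lambda_gt0 : 0 < lambda.
Hypothesis p01 : forall n, (0 < n)%N -> 0 <= p n <= 1.
Hypothesis p_mean : mean (fun n => 1 - p n) n @[n --> \oo] --> lambda.

Let q01 n : (0 < n)%N -> 0 <= 1 - p n <= 1.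
Proof. by move=> /p01/andP[p0 p1]; rewrite subr_ge0 p1 gerBl p0. Qed.

Notation moment k n := (isolated_moment (@cube3_adj n) (p n) k).

Lemma moment_cvg k : moment k n @[n --> \oo] --> lambda ^+ k / k`!%:R.
Proof.
have h1 := @moment_main_cvg _ _ _ q01 p_mean k.
have h2 := @moment_error_cvg _ _ _ lambda_gt0 q01 p_mean k
  (fun n => #|dependent_sets (@cube3_adj n) k|) (fun n => cube3_card_dependent_sets n k).
apply: (squeeze_cvgr _ h1 (l := lambda ^+ k / k`!%:R)); last first.
  by rewrite -[X in _ --> X]addr0; apply: cvgD; [exact: h1|exact: h2].
near=> n; have n0 : (0 < n)%N by near: n; exact: nbhs_infty_gt.
by rewrite cube3_moment_ge ?p01 //= cube3_moment_le ?p01.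
Unshelve. all: by end_near. Qed.

Lemma no_isolated_cvg :
  random_subgraph_prob (@cube3_adj n) (p n) (@no_isolated 'I_(3 ^ n)) @[n --> \oo]
    --> expR (- lambda).
Proof.
apply: (cvg_alternating_exp (b := fun k n => moment k n)) => [|m|m].
- exact: moment_cvg.
- near=> n; have n0 : (0 < n)%N by near: n; exact: nbhs_infty_gt.
  by apply: cube3_bonferroni_upper; exact: p01.
- near=> n; have n0 : (0 < n)%N by near: n; exact: nbhs_infty_gt.
  by apply: cube3_bonferroni_lower; exact: p01.
Unshelve. all: by end_near. Qed.

Lemma gap_cvg :
  (random_subgraph_prob (@cube3_adj n) (p n) (@no_isolated 'I_(3 ^ n)) -
   random_subgraph_prob (@cube3_adj n) (p n) (@connected_graph 'I_(3 ^ n))) @[n --> \oo]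
    --> (0 : R).
Proof.
have t7 : 0 < (3^-1 : R) ^+ 7 by rewrite exprn_gt0 // invr_gt0.
(* A direction fails through the spokes of [S], the spokes of [T] or the hubs. Making each of the
   three at most 3^-7 gives the rate 3^-6 of [unlinked_cvg]. *)
have [K hK] : exists K : nat, (3 / 5 : R) ^+ K.+1 < 3^-1 ^+ 7.
  have /cvgrPdist_lt/(_ _ t7)[M _ hM] : (3 / 5 : R) ^+ n @[n --> \oo] --> (0 : R).
    by apply: cvg_expr; rewrite ger0_norm; lra.
  exists M; have := hM M.+1 (leqnSn M); rewrite /= sub0r normrN.
  by apply: le_lt_trans; exact: ler_norm.
(* An upper bound for the probability that one hub is not fully open, as p >= 2/5 eventually. *)
pose d := (2 * K).+1; pose x : R := 1 - (2 / 5) ^+ (2 ^ 3 ^ d.+1).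
have x01 : 0 <= x < 1.
  rewrite /x subr_ge0 exprn_ile1 /= ?gtrBl ?exprn_gt0 //; lra.
have [M hM] : exists M : nat, x ^+ M < 3^-1 ^+ 7.
  have /cvgrPdist_lt/(_ _ t7)[M _ hM] : x ^+ n @[n --> \oo] --> (0 : R).
    by apply: cvg_expr; rewrite ger0_norm; case/andP: x01.
  exists M; have := hM M (leqnn M); rewrite /= sub0r normrN.
  by apply: le_lt_trans; exact: ler_norm.
have s0 := @small_closed_cvg _ _ _ lambda_gt0 q01 p_mean K (2 ^ 3 ^ K)%:R.
have u0 := @unlinked_cvg R d (2 ^ 3 ^ d)%:R.
apply: (@squeeze_cvgr _ _ _ _ (cst 0) _ _ _ _ (cvg_cst _)); last first.
  by rewrite -[X in _ --> X]addr0; apply: cvgD; [exact: s0|exact: u0].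
near=> n; have n0 : (0 < n)%N by near: n; exact: nbhs_infty_gt.
rewrite cube3_gap_ge0 ?p01 //=.
have /andP[q0 q1] := q01 n0.
have q35 : 1 - p n <= 3 / 5.
  by near: n; apply: (@near_q_le _ _ (fun n => 1 - p n) lambda_gt0 q01 p_mean).
(* Ensures that at least [M] high directions remain once those of the subcube are removed. *)
have nbig : (2 * (M + d) <= n)%N by near: n; exact: nbhs_infty_ge.
apply: cube3_gap_le => //; first exact: p01.
- by move: nbig; rewrite /d; lia.
- have qK : (1 - p n) ^+ K.+1 <= 3^-1 ^+ 7.
    by apply: le_trans (ltW hK); apply: lerXn2r; rewrite ?nnegrE //; lra.
  have xM : (1 - p n ^+ (2 ^ 3 ^ d.+1)) ^+ (n./2 - d) <= 3^-1 ^+ 7.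
    apply: le_trans (ltW hM); case/andP: x01 => x0 x1.
    apply: (@le_trans _ _ (x ^+ (n./2 - d))); last first.
      by apply: ler_wiXn2l => //; [exact: ltW|move: nbig; lia].
    apply: lerXn2r; rewrite ?nnegrE //.
      by rewrite subr_ge0 exprn_ile1 //; lra.
    by rewrite /x lerD2l lerN2; apply: lerXn2r; rewrite ?nnegrE; lra.
  apply: le_trans (lerD (_ : _ <= 3^-1 ^+ 7 *+ 2) xM) _; first by rewrite ler_pMn2r.
  by rewrite [_ ^+ 7]exprS; set z := _ ^+ 6; lra.
- by rewrite exprn_ile1 // ?invr_ge0 // invf_le1 ?ler1n // ltr0n.
Unshelve. all: by end_near. Qed.

End Limits.

Theorem mainTheorem1 (R : realType) (lambda : R) (lambda_gt0 : 0 < lambda)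
    (p eps : nat -> R)
    (p_prob : forall n : nat, (0 < n)%N -> 0 <= p n <= 1)
    (eps_o : (fun n : nat => n%:R * eps n) @ \oo --> (0 : R))
    (p_def : forall n : nat, (0 < n)%N ->
       p n = 1 - (Num.sqrt 3)^-1 * lambda `^ (1 / (2 * n%:R)) * (1 + eps n)) :
  ((fun n : nat =>
      random_subgraph_prob (@cube3_adj n) (p n) (@no_isolated 'I_(3 ^ n)))
     @ \oo --> expR (- lambda)) /\
  ((fun n : nat =>
      random_subgraph_prob (@cube3_adj n) (p n) (@connected_graph 'I_(3 ^ n)))
     @ \oo --> expR (- lambda)).
Proof.
have p_mean : mean (fun n => 1 - p n) n @[n --> \oo] --> lambda.
  apply: (sqrt3_mean_cvg lambda_gt0 eps_o) => n n0.
  by rewrite p_def // opprB addrC subrK.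
have ni := no_isolated_cvg lambda_gt0 p_prob p_mean.
split => //.
have gap := gap_cvg lambda_gt0 p_prob p_mean.
rewrite -[X in _ --> X]subr0.
apply: cvg_trans (cvgB ni gap); apply: near_eq_cvg; near=> n.
by rewrite /= opprB addrC subrK.
Unshelve. all: by end_near. Qed.
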